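(* Let $X$ be a standard Brownian motion started at $0$ under $\mathbb{P}$. Let $f\in\mathcal{C}^1(\mathbb{R}_+,\mathbb{R})$ with $f(0)\ne0$ be infinitely often continuously differentiable, concave, and such that $t\mapsto f(t)/t$ is monotone decreasing. Suppose that $f$ is obtained by the method of images from a positive $\sigma$-finite measure $F$ on $(0,\infty)$ satisfying $\int_0^\infty e^{-\epsilon s^2/2}F(ds)<\infty$ for all $\epsilon>0$, that is: with $$h(t,x)=\frac{1}{\sqrt{2\pi t}}\left(e^{-\frac{x^2}{2t}}-\int_0^\infty e^{-\frac{(x-s)^2}{2t}}F(ds)\right),$$ for each $t>0$ the number $f(t)$ is the unique root $x$ of $h(t,x)=0$, and $\mathbb{P}(T^f>t,X_t\in dx)=h(t,x)\,dx$ on $x\le f(t)$. Let $\beta>0$ and $f^{(\beta)}(t)=(1+\beta t)f\left(\frac{t}{1+\beta t}\right)$. Then $$\mathbb{P}\left(T^{f^{(\beta)}}\in dt\right)=\frac{dt}{\sqrt{2\pi t^3}}\int_0^\infty s\,e^{-\frac{(s-f^{(\beta)}(t))^2}{2t}}\,e^{-\beta\frac{s^2}{2}}F(ds),\qquad t>0.$$ Furthermore, the $\sigma$-finite measure corresponding to the curve $f^{(\beta)}$ in the method of images is $F^{(\beta)}(ds):=e^{-\beta s^2/2}F(ds)$; that is, for each $t>0$, $f^{(\beta)}(t)$ is the unique root $x$ of the equation $$e^{-\frac{x^2}{2t}}-\int_0^\infty e^{-\frac{(x-s)^2}{2t}}e^{-\beta\frac{s^2}{2}}F(ds)=0,$$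 and, on $x\le f^{(\beta)}(t)$, $$\mathbb{P}\left(T^{f^{(\beta)}}>t,\,X_t\in dx\right)=\frac{dx}{\sqrt{2\pi t}}\left(e^{-\frac{x^2}{2t}}-\int_0^\infty e^{-\frac{(x-s)^2}{2t}}e^{-\beta\frac{s^2}{2}}F(ds)\right).$$
   Context: For a continuous curve $g$ on $\mathbb{R}_+=[0,\infty)$ with $g(0)\neq 0$, $T^g=\inf\{s>0:X_s=g(s)\}$, with $\inf\emptyset=+\infty$.
   Formalization: The first-passage density of T^{f^(β)} carries an extra factor 1/2, i.e. dt/(2√(2πt³)) instead of dt/√(2πt³); the printed constant fails already for F=δ_a, f=a/2, where it gives twice the Bachelier–Lévy density. *)

(* Defs.v *)
From HB Require Import structures.
From mathcomp Require Import all_boot all_order all_algebra.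
From mathcomp Require Import all_classical all_reals all_analysis.
From mathcomp Require Import measurable_realfun.

Set Implicit Arguments.
Unset Strict Implicit.
Unset Printing Implicit Defensive.

Import Order.TTheory GRing.Theory Num.Theory.
Import numFieldNormedType.Exports.

Local Open Scope classical_set_scope.
Local Open Scope ring_scope.

(* [derivative_within D f x l]: the difference quotient of f at x, along
   y in D \ {x}, tends to l; at an end point of an interval D this is the
   one-sided derivative. *)
Definition derivative_within (R : realType) (D : set R) (f : R -> R) (x l : R)
    : Prop :=
  (fun y => (f y - f x) / (y - x)) @ within D x^' --> l.

Fixpoint C_within (R : realType) (n : nat) (D : set R) (f : R -> R) : Prop :=
  {within D, continuous f} /\
  if n is m.+1 then
    exists2 g : R -> R,
      (forall x, D x -> derivative_within D f x (g x)) & C_within m D g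
  else True.

(* Only the times t >= 0 of the index type R are constrained, here and in
   [hitting_time].  The second argument of [normal_prob] is the standard
   deviation.  All paths, not just almost all, are continuous, so that events
   about hitting times are measurable although the space is not assumed
   complete. *)
Definition standard_brownian_motion (d : measure_display)
    (Omega : measurableType d) (R : realType) (P : probability Omega R)
    (X : R -> {RV P >-> R}) : Prop :=
  [/\ {ae P, forall w, X 0 w = 0},
      forall w, {within `[0, +oo[, continuous (fun t => X t w)},
      forall s t, 0 <= s -> s < t -> forall B : set R, measurable B ->
        P ((X t \- X s) @^-1` B) = normal_prob 0 (Num.sqrt (t - s)) B
    & forall (n : nat) (t : nat -> R), 0 <= t 0%N -> nondecreasing_seq t ->
      forall B : nat -> set R, (forall i, measurable (B i)) ->
        let E i := (X (t i.+1) \- X (t i)) @^-1` B i in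
        P (\bigcap_(i < n) E i) = (\prod_(i < n) P (E i))%E].

Definition hitting_time (Omega : Type) (R : realType) (X : R -> Omega -> R)
    (g : R -> R) (w : Omega) : \bar R :=
  ereal_inf (EFin @` [set s | 0 < s /\ X s w = g s]).

(* A measure on (0, oo) is represented by a measure F on R of which only the
   restriction to `]0, +oo[ is ever used. *)
Definition images_gap (R : realType)
    (F : {measure set (measurableTypeR R) -> \bar R}) (t x : R) : \bar R :=
  ((expR (- (x ^+ 2 / (2 * t))))%:E
   - \int[F]_(s in `]0%R, +oo[) (expR (- ((x - s) ^+ 2 / (2 * t))))%:E)%E.

Definition images_kernel (R : realType)
    (F : {measure set (measurableTypeR R) -> \bar R}) (t x : R) : \bar R :=
  ((Num.sqrt (2 * pi * t))^-1%:E * images_gap F t x)%E.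

(* [unique A x] says that x is the one and only element satisfying A. *)
Definition obtained_by_images (d : measure_display)
    (Omega : measurableType d) (R : realType) (P : probability Omega R)
    (X : R -> {RV P >-> R}) (f : R -> R)
    (F : {measure set (measurableTypeR R) -> \bar R}) : Prop :=
  [/\ sigma_finite (`]0, +oo[%classic : set R) F,
      forall eps, 0 < eps ->
        (\int[F]_(s in `]0%R, +oo[) (expR (- (eps * s ^+ 2 / 2)))%:E < +oo)%E,
      forall t, 0 < t -> unique (fun x => images_kernel F t x = 0%E) (f t)
    & forall t, 0 < t ->
      forall A : set R, measurable A -> A `<=` `]-oo, f t] ->
        P [set w | (t%:E < hitting_time X f w)%E /\ A (X t w)]
        = (\int[lebesgue_measure]_(x in A) images_kernel F t x)%E].

Definition curve_transform (R : realType) (beta : R) (f : R -> R) (t : R) : R :=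
  (1 + beta * t) * f (t / (1 + beta * t)).

Section tilt.
Context (R : realType) (beta : R).
Variable F : {measure set (measurableTypeR R) -> \bar R}.

Definition tilt (A : set (measurableTypeR R)) : \bar R :=
  (\int[F]_(s in A) (expR (- (beta * s ^+ 2 / 2)))%:E)%E.

Let tilt0 : tilt set0 = 0%E.
Proof. exact: integral_set0. Qed.

Let tilt_ge0 A : (0 <= tilt A)%E.
Proof. by apply: integral_ge0 => s _; rewrite lee_fin expR_ge0. Qed.

Let tilt_sigma_additive : semi_sigma_additive tilt.
Proof.
move=> A mA tA mUA; rewrite /tilt ge0_integral_bigcup//=.
- apply: is_cvg_ereal_nneg_natsum_cond => n _ _; exact: tilt_ge0.
- apply/measurable_EFinP; apply: measurable_funTS.
  apply: measurableT_comp => //; apply: measurableT_comp => //.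
  by apply: measurable_funM => //; apply: measurable_funM.
Qed.

HB.instance Definition _ := isMeasure.Build _ _ _ tilt
  tilt0 tilt_ge0 tilt_sigma_additive.

End tilt.

(* Since [images_kernel] solves the heat equation and vanishes on the boundary,
   the density is -1/2 times its space derivative there: this is the origin of
   the factor 1/2, which the published formula lacks.  It cannot be dropped:
   for F = \d_a and f constant equal to a / 2, g is the line b + mu t with
   b = a / 2 and mu = beta a / 2, and the expression below is the classical
   b / sqrt (2 pi t^3) exp (- (b + mu t)^2 / (2 t)). *)
Definition first_passage_density (R : realType)
    (F : {measure set (measurableTypeR R) -> \bar R}) (beta : R) (g : R -> R)
    (t : R) : \bar R :=
  ((2 * Num.sqrt (2 * pi * t ^+ 3))^-1%:E *
   \int[F]_(s in `]0%R, +oo[)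
     (s * expR (- ((s - g t) ^+ 2 / (2 * t))) * expR (- (beta * s ^+ 2 / 2)))%:E)%E.

(* Main.v *)
Require Import Defs.
From HB Require Import structures.
From mathcomp Require Import all_boot all_order all_algebra.
From mathcomp Require Import all_classical all_reals all_analysis.
From mathcomp Require Import measurable_realfun.
From mathcomp Require Import ring lra.

Set Implicit Arguments.
Unset Strict Implicit.
Unset Printing Implicit Defensive.

Import Order.TTheory GRing.Theory Num.Theory.
Import numFieldNormedType.Exports.

Local Open Scope classical_set_scope.
Local Open Scope ring_scope.

(* Write v(t) = t / (1 + beta t).  The process X_t / (1 + beta t), run with the
   clock v(t), is a Brownian bridge: its law up to time v(t) is absolutely
   continuous with respect to that of X up to time v(t), with the density
   sqrt (1 + beta t) exp (- beta (1 + beta t) x^2 / 2) evaluated at the final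
   value x.  Since X meets the transformed curve at time t exactly when
   X_t / (1 + beta t) meets f at time v(t), the law of X killed at the
   transformed curve is the one of X killed at f times this density, and
   completing the square turns the images kernel of F into that of
   exp (- beta s^2 / 2) F(ds).  The absolute continuity is proved for cylinder
   events by the Markov property, then passed to hitting events along dyadic
   times.

   For the density of the hitting time T of a curve g obtained by images from G,
   integrating the kernel below g(t) gives
   P(T > t) = Phi(g(t) / sqrt t) - int Phi((g(t) - s) / sqrt t) G(ds), and in the
   t-derivative the terms without a factor s cancel because the kernel vanishes
   on the curve. *)

(** * Integration lemmas *)

(** The density of the bridge is a function of the current value alone, compatible with the Brownian
    transitions (a Doob transform). It therefore telescopes along successive times, which is why one
    factor at the final time is all that remains. A hitting event is not determined by finitely many
    times, and strict positivity at dyadic points does not survive the passage to a limit. By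
    continuity, avoiding the curve on [0, t] means that the gap keeps a strict sign, hence has a
    positive minimum in absolute value; the lower bounds 1 / (m + 1) at dyadic points are closed
    conditions, and two monotone limits recover the event. For the density, differentiation under
    the integral over G is replaced by integration over [a, b] and Fubini's theorem. The factor 1/2
    is that of the coefficient 1 / (2 t sqrt t) of s in the derivative of (g(t) - s) / sqrt t. The
    formula for P(T > t) also requires surviving paths to lie below the curve, that is g(0) > 0, a
    sign that the images representation forces. *)

Section measure_lemmas.
Local Open Scope ereal_scope.
Context d (T : measurableType d) (R : realType).
Import HBNNSimple.

(** Both sides are additive and pass to increasing limits of simple functions, so the case of
    indicators, which is the hypothesis on [nu], is enough. The Gaussian law, the tilted measure and
    the law of the killed motion are all handled through it. *)
Lemma ge0_integral_density (mu nu : {measure set T -> \bar R}) (D : set T)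
    (w : T -> R) (phi : T -> \bar R) :
  measurable D -> measurable_fun D w -> (forall x, D x -> 0 <= (w x)%:E) ->
  (forall A, measurable A -> A `<=` D -> nu A = \int[mu]_(x in A) (w x)%:E) ->
  measurable_fun D phi -> (forall x, D x -> 0 <= phi x) ->
  \int[nu]_(x in D) phi x = \int[mu]_(x in D) (phi x * (w x)%:E).
Proof.
move=> mD mw w0 nuE mphi phi0.
have mwE : measurable_fun D (EFin \o w) by exact/measurable_EFinP.
pose f_ := nnsfun_approx mD mphi.
transitivity (limn (fun n => \int[nu]_(x in D) (f_ n x)%:E)).
  rewrite -monotone_convergence//.
  - apply: eq_integral => y /[!inE] yD; apply/esym/cvg_lim => //.
    exact: cvg_nnsfun_approx.
  - by move=> n; exact/measurable_EFinP/measurable_funTS.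
  - by move=> n y _; rewrite lee_fin.
  - by move=> y _ m n mn; rewrite lee_fin; exact/lefP/nd_nnsfun_approx.
transitivity (limn (fun n => \int[mu]_(x in D) ((f_ n x)%:E * (w x)%:E))); last first.
  rewrite -monotone_convergence//.
  - apply: eq_integral => y /[!inE] yD; apply/cvg_lim => //.
    by apply: cvgeZr => //; exact: cvg_nnsfun_approx.
  - move=> n; apply: emeasurable_funM => //.
    exact/measurable_EFinP/measurable_funTS.
  - by move=> n x Dx; apply: mule_ge0; [rewrite lee_fin|exact: w0].
  - move=> x Dx m n mn; apply: lee_wpmul2r; [exact: w0|rewrite lee_fin].
    exact/lefP/nd_nnsfun_approx.
congr (limn _); apply/funext => n.
under eq_integral do rewrite fimfunE -fsumEFin//.
rewrite ge0_integral_fsum//; last 2 first.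
- by move=> y; exact/measurable_EFinP/measurable_funTS/measurable_funM.
- by move=> y x _; rewrite nnfun_muleindic_ge0.
under [RHS]eq_integral => x xD do
  (rewrite fimfunE -fsumEFin// ge0_mule_fsuml//;
   last by move=> ?; rewrite nnfun_muleindic_ge0).
rewrite ge0_integral_fsum//; last 2 first.
- move=> y; apply: emeasurable_funM => //.
  exact/measurable_EFinP/measurable_funTS/measurable_funM.
- by move=> y x Dx; apply: mule_ge0; [exact: nnfun_muleindic_ge0|exact: w0].
apply: eq_fsbigr => r rf; rewrite integralZl_indic_nnsfun// integral_indic//.
under [RHS]eq_integral do rewrite EFinM -muleA.
have r0 : (0 <= r)%R by move: rf; rewrite inE => -[x _ <-].
rewrite ge0_integralZl//; last 2 first.
- apply: emeasurable_funM => //; exact/measurable_EFinP/measurable_funTS.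
- by move=> x Dx; apply: mule_ge0; [rewrite lee_fin|exact: w0].
rewrite setIC nuE; [|exact: measurableI|exact: subIsetl].
congr (_ * _); rewrite [LHS]integral_mkcondr.
apply: eq_integral => x _; rewrite epatch_indic muleC/=.
by [].
Qed.

Lemma ge0_integral_mrestr (mu : {measure set T -> \bar R}) (D : set T)
    (mD : measurable D) (phi : T -> \bar R) :
  measurable_fun setT phi -> (forall x, 0 <= phi x) ->
  \int[mrestr mu mD]_x phi x = \int[mu]_(x in D) phi x.
Proof.
move=> mphi phi0.
rewrite (@ge0_integral_density mu _ setT \1_D)//.
- by rewrite [RHS]integral_mkcond; apply: eq_integral => x _; rewrite epatch_indic.
- by move=> A mA _; rewrite integral_indic// setIC.
Qed.

Lemma exists_density_measure (mu : {measure set T -> \bar R}) (w : T -> \bar R) :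
  measurable_fun setT w -> (forall x, 0 <= w x) ->
  exists nu : {measure set T -> \bar R},
    forall A, nu A = \int[mu]_(x in A) w x.
Proof.
move=> mw w0; pose m A := \int[mu]_(x in A) w x.
have m0 : m set0 = 0 by exact: integral_set0.
have mge0 A : 0 <= m A by exact: integral_ge0.
have msa : semi_sigma_additive m.
  move=> A mA tA mUA; rewrite /m ge0_integral_bigcup//=.
    by apply: is_cvg_ereal_nneg_natsum_cond => n _ _; exact: mge0.
  exact: measurable_funTS.
pose mm := isMeasure.Build _ _ _ m m0 mge0 msa.
pose mu' : {measure set T -> \bar R} := HB.pack m mm.
by exists mu'.
Qed.

(** Product measures and Tonelli's theorem take sigma-finiteness as part of the structure of a
    measure. A measure merely proved sigma-finite is repackaged here with the same values; integrals
    are then transferred by [eq_measure_integral]. *)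
Lemma exists_sigma_finite_measure (mu : {measure set T -> \bar R}) :
  sigma_finite setT mu ->
  exists nu : {sigma_finite_measure set T -> \bar R},
    nu = mu :> (set T -> \bar R).
Proof.
move=> sf; pose m A := mu A.
pose mm := isMeasure.Build _ _ _ m (measure0 mu) (measure_ge0 mu)
  (@measure_semi_sigma_additive _ _ _ mu).
pose m' : {measure set T -> \bar R} := HB.pack m mm.
pose ms := Measure_isSigmaFinite.Build _ _ _ m' sf.
pose nu : {sigma_finite_measure set T -> \bar R} := HB.pack m mm ms.
by exists nu.
Qed.

End measure_lemmas.

Lemma exists_pushforward d d' (T : measurableType d) (T' : measurableType d')
    (R : realType) (mu : {measure set T -> \bar R}) (f : T -> T') :
  measurable_fun setT f ->
  exists2 nu : {measure set T' -> \bar R}, (forall A, nu A = mu (f @^-1` A)) &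
    forall phi : T' -> \bar R, measurable_fun setT phi ->
      (forall y, 0 <= phi y)%E -> (\int[nu]_y phi y = \int[mu]_x phi (f x))%E.
Proof.
move=> mf; have h := @ge0_integral_pushforward _ _ _ _ R _ mf mu setT.
exists (measure_function_pushforward__canonical__measure_function_Measure mu mf) => //.
by move=> phi mphi phi0; apply: h => //.
Qed.


Section affine_change.
Context (R : realType).
Local Notation mu := (@lebesgue_measure R).

(** The image of Lebesgue measure under the affine map, multiplied by [a], gives every half-open
    interval its length; by uniqueness it is Lebesgue measure. *)
Lemma ge0_integral_lebesgue_affine (a b : R) (phi : R -> \bar R) :
  0 < a -> measurable_fun setT phi -> (forall x, 0 <= phi x)%E ->
  (\int[mu]_x phi x = a%:E * \int[mu]_x phi (a * x + b)%R)%E.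
Proof.
move=> a0 mphi phi0.
pose h : measurableTypeR R -> measurableTypeR R := fun x : R => a * x + b.
have mh : measurable_fun setT h.
  by apply: measurable_funD => //; exact: measurable_funM.
have muE A : measurable A -> mu A = mscale (NngNum (ltW a0)) (pushforward mu h) A.
  apply: lebesgue_measure_unique => _ [[x y] _ <-] /=.
  rewrite /mscale /= /pushforward.
  have -> : h @^-1` `]x, y]%classic = `](x - b) / a, (y - b) / a]%classic.
    apply/seteqP; split => z /=; rewrite !in_itv/= /h ltr_pdivrMr// ler_pdivlMr//;
    by rewrite ltrBlDr lerBrDr mulrC.
  rewrite !lebesgue_measure_itv/= !lte_fin ltr_pM2r ?invr_gt0// ltrBlDr subrK.
  case: ifPn => _; last by rewrite mule0.
  rewrite -!EFinB -EFinM; congr EFin; field; lra.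
rewrite (eq_measure_integral (mscale (NngNum (ltW a0)) (pushforward mu h))); last first.
  by move=> A mA _; exact: muE.
rewrite ge0_integral_mscale//= ge0_integral_pushforward//.
Qed.

End affine_change.

(** * Markov property of Brownian motion *)

(** The motion starts at 0 only almost surely, whereas the pathwise descriptions of events assume
    [X 0 w = 0]: events are exchanged up to a null set. *)
Lemma eq_measure_ae d (T : measurableType d) (R : realType)
    (mu : {measure set T -> \bar R}) (A B : set T) :
  measurable A -> measurable B -> {ae mu, forall x, A x <-> B x} -> mu A = mu B.
Proof.
move=> mA mB AB; rewrite -(setIT A) -(setIT B) -!integral_indic//.
apply: ge0_ae_eq_integral => //; try by move=> x _; rewrite lee_fin.
- exact/measurable_EFinP/measurable_indic.
- exact/measurable_EFinP/measurable_indic.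
apply: filterS AB => x ABx _; congr EFin; rewrite !indicE.
by congr (nat_of_bool _)%:R; apply/idP/idP; rewrite !inE => /ABx.
Qed.

Section brownian_motion.
Context d (Omega : measurableType d) (R : realType) (P : probability Omega R).
Variable X : R -> {RV P >-> R}.
Hypothesis HX : standard_brownian_motion X.

Definition cylinder (t : nat -> R) n (B : nat -> set R) :=
  \bigcap_(i < n.+1) (X (t i) @^-1` B i).

Lemma measurable_RV_preimage (Y : {RV P >-> R}) (B : set R) :
  measurable B -> measurable (Y @^-1` B).
Proof. by move=> mB; rewrite -[V in measurable V]setTI; exact: measurable_funP. Qed.

Lemma measurable_cylinder (t : nat -> R) n (B : nat -> set R) :
  (forall i, measurable (B i)) -> measurable (cylinder t n B).
Proof.
by move=> mB; apply: bigcap_measurableType => i _; exact: measurable_RV_preimage.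
Qed.

(** Independence is given for rectangles of increments only. Positions are sums of increments once X
    0 is subtracted, so up to a null set the cylinder lies in the sigma-algebra generated by the
    first [n] increments, to which independence extends by uniqueness of measures on a pi-system. *)
Lemma brownian_independent_increment (t : nat -> R) n (B : nat -> set R) C :
  t 0%N = 0 -> nondecreasing_seq t ->
  (forall i, measurable (B i)) -> measurable C ->
  let Z := (X (t n.+1) \- X (t n)) @^-1` C in
  P (cylinder t n B `&` Z) = (P (cylinder t n B) * P Z)%E.
Proof.
move=> t0 ndt mB mC Z.
have [X0 _ _ indep] := HX.
pose I i := X (t i.+1) \- X (t i).
have mI i : measurable_fun setT (I i) by exact: measurable_funB.
have mI' i D : measurable D -> measurable (I i @^-1` D).
  by move=> mD; rewrite -[V in measurable V]setTI; exact: mI.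
have mZ : measurable Z by exact: (mI' n).
pose G := [set E : set Omega | exists D : nat -> set R,
   (forall i, measurable (D i)) /\ E = \bigcap_(i < n) (I i @^-1` D i)].
have Gm : G `<=` measurable.
  move=> _ [D [mD ->]]; by apply: bigcap_measurableType => // i _; exact: mI'.
have GI : setI_closed G.
  move=> _ _ [D [mD ->]] [D' [mD' ->]]; exists (fun i => D i `&` D' i); split.
    by move=> i; exact: measurableI.
  by rewrite -bigcapI; apply: eq_bigcapr => i _; rewrite preimage_setI.
have GT : G setT.
  by exists (fun=> setT); split=> //; apply/esym; rewrite -subTset.
(* With [Z] fixed, both sides are finite measures in [E]: P restricted to [Z], and P scaled by
   [P Z]. They need only be compared on [G]. *)
have Gindep E : <<s G >> E -> P (E `&` Z) = (P Z * P E)%E.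
  move=> sE.
  pose c := NngNum (fine_ge0 (measure_ge0 P Z)).
  have -> : (P Z * P E)%E = mscale c P E.
    by rewrite /mscale/= fineK// fin_num_measure.
  rewrite -[LHS]/(mrestr P mZ E).
  apply: (@g_sigma_algebra_measure_unique _ _ _ G Gm (fun=> setT) (fun=> GT)) => //.
  - by rewrite bigcup_const//; exists 0%N.
  - move=> _ [D [mD ->]] /=; rewrite /mrestr /mscale/= fineK ?fin_num_measure//.
    (* [C] becomes the constraint on the increment of index [n]; comparing independence of n + 1 and
       of n increments splits off its factor. *)
    pose D' i := if i == n then C else D i.
    have mD' i : measurable (D' i) by rewrite /D'; case: ifP.
    have t00 : 0 <= t 0%N by rewrite t0.
    have D'n : D' n = C by rewrite /D' eqxx.
    have /= := indep n.+1 t t00 ndt D' mD'.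
    rewrite big_ord_recr/= D'n muleC => h.
    have /= h' := indep n t t00 ndt D' mD'.
    rewrite -h' in h.
    have e : \bigcap_(i < n) (I i @^-1` D i) = \bigcap_(i < n) ((X (t i.+1) \- X (t i)) @^-1` D' i).
      by apply: eq_bigcapr => i /= ni; rewrite /D' lt_eqF.
    rewrite e -h; congr (P _); apply/seteqP; split => w /=.
      move=> [Dw Zw] i /= ; rewrite ltnS leq_eqVlt => /predU1P[->|ni].
        by rewrite /D' eqxx.
      exact: Dw.
    move=> Dw; split; first by move=> i /= ni; apply: Dw => /=; exact: ltnW.
    by have := Dw n (ltnSn n); rewrite /D' eqxx.
  - by move=> k; rewrite /= /mrestr setTI ltey_eq fin_num_measure.
(* Omega with the sigma-algebra of the increments: the positions relative to time 0 are measurable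
   for it, by induction on the index. *)
pose GS := g_sigma_algebraType G.
pose W i := X (t i) \- X 0.
have mIG i : (i < n)%N -> measurable_fun (setT : set GS) (I i : GS -> R).
  move=> ni _ D mD; rewrite setTI; apply: sub_sigma_algebra.
  exists (fun j => if j == i then D else setT); split.
    by move=> j; case: ifP.
  apply/seteqP; split => w /=.
    by move=> Dw j _; case: eqP => [->|].
  by move=> /(_ i ni); rewrite eqxx.
have mW i : (i <= n)%N -> measurable_fun (setT : set GS) (W i : GS -> R).
  elim: i => [_|i IH ni].
    rewrite (_ : W 0%N = cst 0); first exact: measurable_cst.
    by apply/funext => w; rewrite /W t0 /= subrr.
  rewrite (_ : W i.+1 = W i \+ I i); last first.
    by apply/funext => w; rewrite /W /I /=; lra.
  exact: measurable_funD (IH (ltnW ni)) (mIG i ni).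
pose past' := \bigcap_(i < n.+1) (W i @^-1` B i).
have spast : <<s G >> past'.
  apply: (@bigcap_measurableType _ GS) => i ni.
  by have := mW i ni measurableT (B i) (mB i); rewrite setTI.
have mpast' : measurable past' by apply: smallest_sub spast => //; exact: sigma_algebra_measurable.
have mpast : measurable (cylinder t n B).
  apply: bigcap_measurableType => i _; exact: measurable_RV_preimage.
have pastE : {ae P, forall w, cylinder t n B w <-> past' w}.
  apply: filterS X0 => w X0w; split => + i ni => /(_ i ni) /=; rewrite /W /= X0w subr0//.
have -> : P (cylinder t n B `&` Z) = P (past' `&` Z).
  apply: eq_measure_ae; [exact: measurableI|exact: measurableI|].
  by apply: filterS pastE => w [h1 h2]; split => -[pw Zw]; split => //; [exact: h1|exact: h2].
have -> : P (cylinder t n B) = P past' by exact: eq_measure_ae.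
by rewrite Gindep// muleC.
Qed.

(** Under P restricted to the cylinder, the last position and the next increment have a product law,
    as is checked on rectangles. Tonelli's theorem and the Gaussian law of the increment give the
    inner integral. *)
Lemma brownian_markov (t : nat -> R) n (B : nat -> set R) (phi : R -> \bar R) :
  t 0%N = 0 -> nondecreasing_seq t -> t n < t n.+1 ->
  (forall i, measurable (B i)) ->
  measurable_fun setT phi -> (forall x, 0 <= phi x)%E ->
  (\int[P]_(w in cylinder t n B) phi (X (t n.+1) w) =
   \int[P]_(w in cylinder t n B)
     \int[lebesgue_measure]_z (phi (X (t n) w + z)%R *
       (normal_pdf 0 (Num.sqrt (t n.+1 - t n)) z)%:E))%E.
Proof.
move=> t0 ndt tn mB mphi phi0.
have [_ _ gauss _] := HX.
have tn0 : 0 <= t n by rewrite -t0; exact: ndt.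
set G := cylinder t n B.
have mG : measurable G.
  by apply: bigcap_measurableType => i _; exact: measurable_RV_preimage.
set V := X (t n); pose Z := X (t n.+1) \- X (t n).
set s := Num.sqrt _.
have mZ : measurable_fun setT Z by exact: measurable_funB.
pose J w : R * measurableTypeR R := (V w, Z w).
have mJ : measurable_fun setT J by exact: measurable_fun_pair.
have [mV0 mV0E mV0I] := exists_pushforward (mrestr P mG) (measurable_funPT V).
have [mJ0 mJ0E mJ0I] := exists_pushforward (mrestr P mG) mJ.
have [mV mVE] : exists nu : {sigma_finite_measure set R -> \bar R},
    nu = mV0 :> (set R -> \bar R).
  apply: exists_sigma_finite_measure; apply: fin_num_fun_sigma_finite => //=.
    by rewrite measure0.
  move=> A mA; rewrite mV0E; apply: fin_num_measure.
  exact: measurable_RV_preimage.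
pose N : {sigma_finite_measure set (measurableTypeR R) -> \bar R} := normal_prob 0 s.
pose psi (p : R * measurableTypeR R) := phi (p.1 + p.2).
have mpsi : measurable_fun setT psi.
  by apply: measurableT_comp => //; exact: measurable_funD.
have psi0 p : (0 <= psi p)%E by exact: phi0.
have joint A : measurable A -> (mV \x N)%E A = mJ0 A.
  apply: product_measure_unique => C D mC mD.
  rewrite mVE mJ0E mV0E /= /mrestr /N/= -gauss//.
  (* A constraint on the last position is absorbed into the cylinder, so that independence of the
     next increment applies to the rectangle. *)
  pose B' i := if i == n then B i `&` C else B i.
  have mB' i : measurable (B' i).
    by rewrite /B'; case: ifP => _ //; exact: measurableI.
  have GE : V @^-1` C `&` G = cylinder t n B'.
    apply/seteqP; split => w /=.
      move=> [Cw Gw] i ni; rewrite /B' /=; case: ifPn => [/eqP|_].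
        by move=> ->; split => //; apply: (Gw n) => /=.
      exact: (Gw i).
    move=> Gw; split; first by have := Gw n (ltnSn n); rewrite /B' /= eqxx => -[].
    by move=> i ni; have := Gw i ni; rewrite /B' /=; case: ifP => // _ [].
  have := brownian_independent_increment n t0 ndt mB' mD.
  rewrite /= -GE => <-; congr (P _); apply/seteqP; split => w /=.
    by move=> [[? ?] ?].
  by move=> [[? ?] ?].
transitivity (\int[mrestr P mG]_w psi (J w))%E.
  rewrite ge0_integral_mrestr//; last exact: measurableT_comp.
  apply: eq_integral => w _; rewrite /psi /J /V /Z /=; congr phi; lra.
rewrite -mJ0I//.
rewrite (eq_measure_integral (mV \x N)%E); last by move=> A mA _; exact/esym/joint.
rewrite fubini_tonelli1//=.
have mF : measurable_fun setT (fubini_F N psi) by exact: measurable_fun_fubini_tonelli_F.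
have F0 x : (0 <= fubini_F N psi x)%E by exact: integral_ge0.
rewrite (eq_measure_integral (mV0 : {measure set R -> \bar R})); last first.
  by move=> A mA _; exact: (congr1 (fun m => m A) mVE).
rewrite mV0I// ge0_integral_mrestr//; last exact: measurableT_comp.
apply: eq_integral => w _; rewrite /fubini_F /psi /=.
rewrite (@ge0_integral_density _ _ _ lebesgue_measure N setT (normal_pdf 0 s))//.
- exact: measurable_normal_pdf.
- by move=> x _; rewrite lee_fin normal_pdf_ge0.
- apply: measurableT_comp => //; exact: measurable_funD.
Qed.

End brownian_motion.

(** * Time change and bridge density *)

Section time_change.
Context (R : realType) (beta : R).
Hypothesis beta_gt0 : 0 < beta.
Local Notation mu := (@lebesgue_measure R).

(** A bridge of length 1 / beta has at time v = t / (1 + beta t) the residual time 1 / beta - v = 1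
    / (beta (1 + beta t)). The formula is the centred Gaussian density of that variance at x,
    divided by the one of variance 1 / beta at 0. *)
Definition bridge_density (t x : R) : R :=
  Num.sqrt (1 + beta * t) * expR (- (beta * (1 + beta * t) * x ^+ 2 / 2)).

Lemma bridge_density_ge0 t x : 0 <= bridge_density t x.
Proof. by rewrite mulr_ge0 ?sqrtr_ge0// expR_ge0. Qed.

Lemma measurable_bridge_density t : measurable_fun setT (bridge_density t).
Proof.
apply: measurable_funM => //; apply: measurableT_comp => //.
apply: measurableT_comp => //.
apply: measurable_funM => //; apply: measurable_funM => //.
Qed.

Definition bridge_time (t : R) := t / (1 + beta * t).

Lemma onebt_gt0 t : 0 <= t -> 0 < 1 + beta * t.
Proof. by move=> t0; rewrite ltr_pwDl// mulr_ge0// ltW. Qed.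

Lemma bridge_timeB s t : 0 <= s -> 0 <= t -> bridge_time t - bridge_time s =
  (t - s) / ((1 + beta * s) * (1 + beta * t)).
Proof.
move=> s0 t0; rewrite /bridge_time; field.
by rewrite !gt_eqF// onebt_gt0.
Qed.

Lemma bridge_time_lt s t : 0 <= s -> s < t -> bridge_time s < bridge_time t.
Proof.
move=> s0 st; have t0 : 0 <= t by lra.
rewrite -subr_gt0 bridge_timeB// divr_gt0 ?subr_gt0//.
by rewrite mulr_gt0// onebt_gt0.
Qed.

(** The Doob-transform relation between the two transition densities. If X_s / (1 + beta s) = x,
    then X_t / (1 + beta t) = x + y exactly when the increment of X is (1 + beta t) y + beta (t - s)
    x; the factor 1 + beta t is the Jacobian. *)
Lemma gaussian_density_time_change s t x y : 0 <= s -> s < t ->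
  (1 + beta * t) * normal_pdf 0 (Num.sqrt (t - s))
    ((1 + beta * t) * y + beta * (t - s) * x) * bridge_density s x =
  bridge_density t (x + y) *
    normal_pdf 0 (Num.sqrt (bridge_time t - bridge_time s)) y.
Proof.
move=> s0 st; have t0 : 0 <= t by lra.
have a0 := onebt_gt0 s0; have b0 := onebt_gt0 t0.
rewrite bridge_timeB// /bridge_density.
(* Eliminating beta through b - a makes the exponents rational in a, b, t - s, x and y. *)
have eb : beta * (t - s) = (1 + beta * t) - (1 + beta * s) by lra.
rewrite eb; move: eb a0 b0.
set a := 1 + beta * s; set b := 1 + beta * t => eb a0 b0.
clearbody a b.
have D0 : 0 < t - s by lra.
have ab0 : 0 < a * b by exact: mulr_gt0.
rewrite !normal_pdfE ?gt_eqF ?sqrtr_gt0 ?divr_gt0//.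
rewrite /normal_peak /normal_fun !sqr_sqrtr; [|by rewrite ltW// divr_gt0|exact: ltW].
rewrite !subr0.
have -> : (t - s) / (a * b) * pi *+ 2 = ((t - s) * pi *+ 2) / (a * b).
  by field; rewrite !gt_eqF.
have pi0 := @pi_gt0 R.
rewrite sqrtrM; last by rewrite mulrn_wge0// mulr_ge0 ?ltW.
rewrite sqrtrV ?ltW// sqrtrM ?ltW//.
set D := Num.sqrt (_ *+ 2).
have DD : 0 < D by rewrite sqrtr_gt0 pmulrn_lgt0// mulr_gt0.
have ea := sqr_sqrtr (ltW a0); have ebb := sqr_sqrtr (ltW b0).
have sa : 0 < Num.sqrt a by rewrite sqrtr_gt0.
have sb : 0 < Num.sqrt b by rewrite sqrtr_gt0.
(* Both sides carry the prefactor b sqrt a / D; what remains is an equality of exponents. *)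
transitivity (b * Num.sqrt a / D *
  expR (- (b * y + (b - a) * x) ^+ 2 / ((t - s) *+ 2) - beta * a * x ^+ 2 / 2)).
  rewrite expRD; ring.
transitivity (b * Num.sqrt a / D *
  expR (- y ^+ 2 / (((t - s) / (a * b)) *+ 2) - beta * b * (x + y) ^+ 2 / 2)); last first.
  rewrite expRD -{1}ebb; field; by rewrite !gt_eqF.
congr (_ * expR _).
have -> : beta = (b - a) / (t - s) by rewrite -eb; field; rewrite gt_eqF.
field; by rewrite !gt_eqF.
Qed.

Lemma gaussian_step_time_change s t x (phi : R -> \bar R) :
  0 <= s -> s < t -> measurable_fun setT phi -> (forall x, 0 <= phi x)%E ->
  (\int[mu]_z (phi (((1 + beta * s) * x + z) / (1 + beta * t))%R *
      (normal_pdf 0 (Num.sqrt (t - s)) z)%:E) * (bridge_density s x)%:E =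
   \int[mu]_z (phi (x + z)%R * (bridge_density t (x + z))%:E *
      (normal_pdf 0 (Num.sqrt (bridge_time t - bridge_time s)) z)%:E))%E.
Proof.
move=> s0 st mphi phi0; have t0 : 0 <= t by lra.
have a0 := onebt_gt0 s0; have b0 := onebt_gt0 t0.
have mpdf r : measurable_fun setT (fun z => (normal_pdf 0 r z)%:E : \bar R).
  by apply/measurable_EFinP; exact: measurable_normal_pdf.
set a := 1 + beta * s in a0 *; set b := 1 + beta * t in b0 *.
have mlin : measurable_fun setT (fun z => (a * x + z) / b).
  by apply: measurable_funM => //; exact: measurable_funD.
have maff : measurable_fun setT (fun z => b * z + beta * (t - s) * x).
  by apply: measurable_funD => //; exact: measurable_funM.
have mphipdf : measurable_fun setT (fun z =>
    phi ((a * x + z) / b)%R * (normal_pdf 0 (Num.sqrt (t - s)) z)%:E)%E.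
  by apply: emeasurable_funM => //; exact: (measurableT_comp mphi mlin).
rewrite (ge0_integral_lebesgue_affine (beta * (t - s) * x) b0)//; last first.
  by move=> z; rewrite mule_ge0// lee_fin normal_pdf_ge0.
rewrite muleAC -EFinM -ge0_integralZl//; last 3 first.
- exact: (measurableT_comp mphipdf maff).
- by move=> z _; rewrite mule_ge0// lee_fin normal_pdf_ge0.
- by rewrite lee_fin mulr_ge0// ?bridge_density_ge0// ltW.
rewrite /a /b; apply: eq_integral => z _; rewrite muleCA -!muleA; congr (_ * _)%E.
  by congr phi; field; rewrite gt_eqF.
rewrite -!EFinM -gaussian_density_time_change//; congr EFin; ring.
Qed.

Lemma bridge_time0 : bridge_time 0 = 0.
Proof. by rewrite /bridge_time mul0r. Qed.

Lemma bridge_density0 : bridge_density 0 0 = 1.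
Proof.
by rewrite /bridge_density mulr0 addr0 sqrtr1 expr0n/= mulr0 mul0r oppr0 expR0 mulr1.
Qed.

Section cylinders.
Context d (Omega : measurableType d) (P : probability Omega R).
Variable X : R -> {RV P >-> R}.
Hypothesis HX : standard_brownian_motion X.

(** By induction on the number of times. The test function stays arbitrary because the induction
    hypothesis is applied to the conditional expectation of the last step; the density at time [t n]
    that it produces is then traded, through one Gaussian transition, for the density at time
    [t n.+1]. *)
Lemma brownian_time_change (t : nat -> R) n (B : nat -> set R)
    (phi : R -> \bar R) :
  t 0%N = 0 -> (forall i, t i < t i.+1) -> (forall i, measurable (B i)) ->
  measurable_fun setT phi -> (forall x, 0 <= phi x)%E ->
  let v i := bridge_time (t i) in
  (\int[P]_(w in cylinder X t n (fun i => [set x : R | B i (x / (1 + beta * t i))%R]))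
     phi (X (t n) w / (1 + beta * t n))%R =
   \int[P]_(w in cylinder X v n B)
     (phi (X (v n) w) * (bridge_density (t n) (X (v n) w))%:E))%E.
Proof.
move=> t0 tS mB mphi phi0 v.
have ndt : nondecreasing_seq t by apply/nondecreasing_seqP => i; exact: ltW.
have tge0 i : 0 <= t i by rewrite -t0; exact: ndt.
have vS i : v i < v i.+1 by exact: bridge_time_lt.
have v0 : v 0%N = 0 by rewrite /v t0 bridge_time0.
have ndv : nondecreasing_seq v by apply/nondecreasing_seqP => i; exact: ltW.
pose B' i := [set x | B i (x / (1 + beta * t i))].
have mdiv (c : R) : measurable_fun setT (fun x : R => x / c) by exact: measurable_funM.
have mB' i : measurable (B' i).
  by have := mdiv (1 + beta * t i) measurableT _ (mB i); rewrite setTI.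
rewrite -/B'.
have cylS (u : nat -> R) m (D : nat -> set R) :
    cylinder X u m.+1 D = cylinder X u m D `&` X (u m.+1) @^-1` D m.+1.
  apply/seteqP; split => w /=.
    move=> Dw; split; last by apply: (Dw m.+1) => /=.
    by move=> i im; apply: Dw => /=; exact: ltnW.
  move=> [Dw Dm] i /=; rewrite ltnS leq_eqVlt => /predU1P[->//|im].
  exact: Dw.
elim: n phi mphi phi0 => [|n IH] phi mphi phi0.
  (* At time 0 the two clocks agree, and the density is 1 at X 0 = 0. *)
  have [X0 _ _ _] := HX.
  have -> : cylinder X t 0 B' = cylinder X v 0 B.
    apply: eq_bigcapr => i /=; rewrite ltnS leqn0 => /eqP ->.
    by rewrite /B' t0 v0 mulr0 addr0; under eq_fun do rewrite divr1.
  rewrite t0 v0 mulr0 addr0.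
  apply: ge0_ae_eq_integral => //.
  - exact: measurable_cylinder.
  - apply: measurable_funTS.
    exact: (measurableT_comp mphi (measurableT_comp (mdiv 1) (measurable_funPT (X 0)))).
  - apply: measurable_funTS; apply: emeasurable_funM.
      exact: (measurableT_comp mphi (measurable_funPT (X 0))).
    apply/measurable_EFinP; apply: measurableT_comp => //.
    exact: measurable_bridge_density.
  - by move=> w _; rewrite mule_ge0// lee_fin bridge_density_ge0.
  - by apply: filterS X0 => w X0w _; rewrite X0w bridge_density0 mul0r mule1.
(* The constraint at the last time moves into the test function, which leaves a cylinder with one
   time fewer. *)
pose phi' y := (phi y * (\1_(B n.+1) y)%:E)%E.
have mphi' : measurable_fun setT phi'.
  apply: emeasurable_funM => //; exact/measurable_EFinP/measurable_indic.
have phi'0 x : (0 <= phi' x)%E by rewrite mule_ge0// lee_fin.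
have tn1 := tge0 n.+1; have tn := tge0 n.
pose b := 1 + beta * t n.+1; pose a := 1 + beta * t n.
have mphib : measurable_fun setT (fun y : R => phi' (y / b)%R).
  exact: (measurableT_comp mphi' (mdiv b)).
(* The conditional expectation of the last factor, given the scaled position x at time [t n]. *)
pose psi x := (\int[mu]_z (phi' ((a * x + z) / b)%R *
  (normal_pdf 0 (Num.sqrt (t n.+1 - t n)) z)%:E))%E.
have mpsi : measurable_fun setT psi.
  pose g (p : R * measurableTypeR R) := (phi' ((a * p.1 + p.2) / b)%R *
    (normal_pdf 0 (Num.sqrt (t n.+1 - t n)) p.2)%:E)%E.
  have mg : measurable_fun setT g.
    apply: emeasurable_funM.
      apply: (measurableT_comp mphib); apply: measurable_funD => //.
      exact: measurable_funM.
    apply/measurable_EFinP; apply: (@measurableT_comp _ _ _ _ _ _ (normal_pdf 0 _)) => //.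
    exact: measurable_normal_pdf.
  apply: (@measurable_fun_fubini_tonelli_F _ _ _ _ _ mu g mg) => p.
  by rewrite mule_ge0// lee_fin normal_pdf_ge0.
have psi0 x : (0 <= psi x)%E.
  by apply: integral_ge0 => z _; rewrite mule_ge0// lee_fin normal_pdf_ge0.
transitivity (\int[P]_(w in cylinder X t n B') phi' (X (t n.+1) w / b)%R)%E.
  rewrite cylS integral_mkcondr; apply: eq_integral => w _.
  by rewrite epatch_indic.
rewrite (brownian_markov HX t0 ndt (tS n) mB' mphib)//.
transitivity (\int[P]_(w in cylinder X t n B') psi (X (t n) w / a)%R)%E.
  apply: eq_integral => w _; rewrite /psi; apply: eq_integral => z _.
  congr (phi' (_ / _)%R * _)%E; congr (_ + _); field.
  by rewrite gt_eqF// onebt_gt0.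
rewrite IH//.
pose phiL y := (phi' y * (bridge_density (t n.+1) y)%:E)%E.
have mphiL : measurable_fun setT phiL.
  apply: emeasurable_funM => //; apply/measurable_EFinP; exact: measurable_bridge_density.
transitivity (\int[P]_(w in cylinder X v n B) phiL (X (v n.+1) w))%E; last first.
  rewrite cylS [RHS]integral_mkcondr; apply: eq_integral => w _.
  by rewrite epatch_indic /phiL /phi' muleAC.
rewrite (brownian_markov HX v0 ndv (vS n) mB mphiL)//; last first.
  by move=> y; rewrite mule_ge0// lee_fin bridge_density_ge0.
by apply: eq_integral => w _; rewrite gaussian_step_time_change.
Qed.

End cylinders.

End time_change.

(** * Hitting events along dyadic times *)

Section dyadic.
Context (R : realType).
Implicit Types (a b c s : R) (z : R -> R).

(** The index is not capped at 2 ^ k: for a < b the times form an infinite strictly increasing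
    sequence, the form in which cylinders take their times. *)
Definition dyadic a b k i : R := a + (b - a) * (i%:R / 2 ^+ k).

Lemma dyadic_in a b k i : a <= b -> (i <= 2 ^ k)%N -> dyadic a b k i \in `[a, b].
Proof.
move=> ab ik; rewrite in_itv/= /dyadic lerDl mulr_ge0 ?subr_ge0 ?divr_ge0 ?exprn_ge0//=.
rewrite -lerBrDl ler_piMr ?subr_ge0// ler_pdivrMr ?exprn_gt0// mul1r.
by rewrite -natrX ler_nat.
Qed.

Lemma dyadicS a b k i : dyadic a b k.+1 i.*2 = dyadic a b k i.
Proof.
rewrite /dyadic -muln2 natrM exprS; congr (_ + _ * _).
by field; rewrite expf_neq0.
Qed.

Lemma dyadic_dense a b s e : a < b -> s \in `[a, b] -> 0 < e ->
  exists k i, (i <= 2 ^ k)%N /\ `|s - dyadic a b k i| < e.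
Proof.
move=> ab; rewrite in_itv/= => /andP[as_ sb] e0.
have ba0 : 0 < b - a by rewrite subr_gt0.
have eba : 0 < e / (b - a) by exact: divr_gt0.
have [k _ /(_ k (leqnn k)) kP] := near_infty_natSinv_expn_lt (PosNum eba).
rewrite /= in kP; exists k.
pose r := (s - a) / (b - a) * 2 ^+ k; exists (Num.truncn r).
have k0 : 0 < 2 ^+ k :> R by rewrite exprn_gt0.
have r0 : 0 <= r by apply: mulr_ge0; [apply: divr_ge0; [rewrite subr_ge0|exact: ltW]|exact: ltW].
have /andP[r1 r2] := truncn_itv r0.
have r3 : r <= 2 ^+ k.
  by rewrite -[leRHS]mul1r ler_wpM2r ?(ltW k0)// ler_pdivrMr// mul1r lerD2r.
split; first by rewrite -(ler_nat R) natrX (le_trans r1).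
have -> : s - dyadic a b k (Num.truncn r) = (b - a) * ((r - (Num.truncn r)%:R) / 2 ^+ k).
  by rewrite /dyadic /r; field; rewrite !gt_eqF.
have n0 : 0 <= r - (Num.truncn r)%:R by rewrite subr_ge0.
rewrite normrM gtr0_norm// mulrC -ltr_pdivlMr// ger0_norm ?divr_ge0 ?(ltW k0)//.
apply: le_lt_trans kP; rewrite div1r ler_piMl ?invr_ge0 ?(ltW k0)//.
by move: r2; rewrite -natr1; lra.
Qed.

Lemma dyadic_ge_path z a b c : a < b -> {within `[a, b], continuous z} ->
  (forall k i, (i <= 2 ^ k)%N -> c <= z (dyadic a b k i)) ->
  forall s, s \in `[a, b] -> c <= z s.
Proof.
move=> ab zc H s sab; rewrite leNgt; apply/negP => zs.
have zs_cvg : z @ within `[a, b]%classic (nbhs s) --> z s.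
  by move/subspace_continuousP : zc; exact.
have /zs_cvg : nbhs (z s) [set y | y < c] by exact: lt_nbhsl.
rewrite /= withinE /= => -[V /nbhs_ballP[e e0 eV] VE].
have [k [i [ik ie]]] := dyadic_dense ab sab e0.
have ki := dyadic_in (ltW ab) ik.
have : (V `&` `[a, b]) (dyadic a b k i) by split => //; exact: eV.
by rewrite -VE => -[/= ]; rewrite ltNge H.
Qed.

(** A continuous positive path attains a positive minimum on a compact interval. A uniform bound
    [m.+1%:R^-1] is a closed condition, hence decided by the dyadic points; mere positivity at these
    points would allow a zero elsewhere. *)
Lemma path_gt0P z a b : a < b -> {within `[a, b], continuous z} ->
  (forall s, s \in `[a, b] -> 0 < z s) <->
  exists m, forall k i, (i <= 2 ^ k)%N -> m.+1%:R^-1 <= z (dyadic a b k i).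
Proof.
move=> ab zc; split => [zpos|[m zm] s sab].
  have [c cab cmin] := EVT_min (ltW ab) zc.
  have zc0 := zpos _ cab.
  have [m _ /(_ m (leqnn m)) mP] := near_infty_natSinv_lt (PosNum zc0).
  exists m => k i ik; apply: (le_trans (ltW mP)) => /=.
  by apply: cmin; apply: dyadic_in => //; exact: ltW.
apply: (@lt_le_trans _ _ m.+1%:R^-1); first by rewrite invr_gt0.
exact: (dyadic_ge_path ab zc).
Qed.

End dyadic.

Section positive_paths.
Context d (T : measurableType d) (R : realType) (a b : R).
Hypothesis ab : a < b.
Implicit Type Z : R -> T -> R.

Definition dyadic_event Z m k : set T :=
  \bigcap_(i < (2 ^ k).+1) (Z (dyadic a b k i) @^-1` `[m.+1%:R^-1, +oo[).

Definition positive_paths Z : set T := [set w | forall s, s \in `[a, b] -> 0 < Z s w].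

Section measurability.
Variable Z : R -> T -> R.
Hypotheses (mZ : forall s, measurable_fun setT (Z s))
  (cZ : forall w, {within `[a, b], continuous (fun s => Z s w)}).

Lemma measurable_dyadic_event m k : measurable (dyadic_event Z m k).
Proof.
by apply: bigcap_measurableType => i _; rewrite -[V in measurable V]setTI; exact: mZ.
Qed.

Lemma positive_pathsE :
  positive_paths Z = \bigcup_m \bigcap_k dyadic_event Z m k.
Proof.
apply/seteqP; split => w /=.
  move=> /(path_gt0P ab (@cZ w))[m mP]; exists m => // k _ i /=.
  by rewrite ltnS in_itv/= andbT => /mP.
move=> [m _ mP]; apply/(path_gt0P ab (@cZ w)); exists m => k i ik.
by have := mP k I i ik; rewrite /= in_itv/= andbT.
Qed.

Lemma measurable_positive_paths : measurable (positive_paths Z).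
Proof.
rewrite positive_pathsE; apply: bigcupT_measurable => m.
by apply: bigcapT_measurable => k; exact: measurable_dyadic_event.
Qed.

Lemma dyadic_event_nonincreasing m : nonincreasing_seq (dyadic_event Z m).
Proof.
apply/nonincreasing_seqP => k; apply/subsetPset => w H i /= ik.
rewrite -dyadicS; apply: (H i.*2) => /=.
by rewrite ltnS expnS mul2n leq_double.
Qed.

Lemma bigcap_dyadic_event_nondecreasing :
  nondecreasing_seq (fun m => \bigcap_k dyadic_event Z m k).
Proof.
apply/nondecreasing_seqP => m; apply/subsetPset => w H k _ i ik.
have := H k I i ik; rewrite /= !in_itv/= !andbT; apply: le_trans.
by rewrite lef_pV2 ?posrE// ler_nat.
Qed.

End measurability.

(** The dyadic events decrease in [k], and their intersections increase in [m]. Agreement at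
    finitely many times passes to the limit by continuity from above, where the finite masses enter,
    and then from below. *)
Lemma eq_measure_positive_paths (Z Z' : R -> T -> R)
    (mu mu' : {measure set T -> \bar R}) :
  (forall s, measurable_fun setT (Z s)) ->
  (forall s, measurable_fun setT (Z' s)) ->
  (forall w, {within `[a, b], continuous (fun s => Z s w)}) ->
  (forall w, {within `[a, b], continuous (fun s => Z' s w)}) ->
  (mu setT < +oo)%E -> (mu' setT < +oo)%E ->
  (forall m k, mu (dyadic_event Z m k) = mu' (dyadic_event Z' m k)) ->
  mu (positive_paths Z) = mu' (positive_paths Z').
Proof.
move=> mZ mZ' cZ cZ' fin fin' H.
have mcap (V : R -> T -> R) m : (forall s, measurable_fun setT (V s)) ->
    measurable (\bigcap_k dyadic_event V m k).
  by move=> mV; apply: bigcapT_measurable => k; exact: measurable_dyadic_event.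
have cap (V : R -> T -> R) (nu : {measure set T -> \bar R}) m :
    (forall s, measurable_fun setT (V s)) -> (nu setT < +oo)%E ->
    nu (\bigcap_k dyadic_event V m k) = limn (nu \o dyadic_event V m).
  move=> mV nuoo; apply/esym/cvg_lim => //; apply: nonincreasing_cvg_mu.
  - apply: le_lt_trans nuoo; apply: le_measure; rewrite ?inE//.
    exact: measurable_dyadic_event.
  - by move=> k; exact: measurable_dyadic_event.
  - exact: mcap.
  - exact: dyadic_event_nonincreasing.
have cup (V : R -> T -> R) (nu : {measure set T -> \bar R}) :
    (forall s, measurable_fun setT (V s)) ->
    (forall w, {within `[a, b], continuous (fun s => V s w)}) ->
    nu (positive_paths V) = limn (fun m => nu (\bigcap_k dyadic_event V m k)).
  move=> mV cV; rewrite positive_pathsE//; apply/esym/cvg_lim => //.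
  apply: nondecreasing_cvg_mu.
  - by move=> m; exact: mcap.
  - by apply: bigcupT_measurable => m; exact: mcap.
  - exact: bigcap_dyadic_event_nondecreasing.
rewrite !cup//; congr (limn _); apply/funext => m.
by rewrite !cap//; congr (limn _); apply/funext => k /=; exact: H.
Qed.

End positive_paths.

(** * Sign of continuous paths and hitting times *)

Section path_sign.
Context (R : realType).
Implicit Types (z : R -> R) (a b : R).

Lemma path_neq0P z a b : a <= b -> {within `[a, b], continuous z} ->
  (forall s, s \in `[a, b] -> z s != 0) <->
  (forall s, s \in `[a, b] -> 0 < z s) \/ (forall s, s \in `[a, b] -> 0 < - z s).
Proof.
move=> ab zc; split; last first.
  move=> [zpos|zneg] s sab; first by rewrite gt_eqF// zpos.
  by rewrite lt_eqF// -oppr_gt0 zneg.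
move=> z0.
have aab : a \in `[a, b] by rewrite in_itv/= lexx.
have sub s : s \in `[a, b] -> {within `[a, s], continuous z}.
  rewrite in_itv/= => /andP[_ sb]; apply: continuous_subspaceW zc.
  by apply: subset_itvl; rewrite bnd_simp.
have key s : s \in `[a, b] -> Num.min (z a) (z s) <= 0 <= Num.max (z a) (z s) -> False.
  move=> sab zz; have as_ : a <= s by move: sab; rewrite in_itv/= => /andP[].
  have [c cas zc0] := IVT as_ (sub _ sab) zz.
  have /z0 : c \in `[a, b].
    move: sab cas; rewrite !in_itv/= => /andP[_ sb] /andP[-> cs]/=.
    exact: le_trans cs sb.
  by rewrite zc0 eqxx.
have := z0 _ aab; rewrite neq_lt => /orP[za|za]; [right|left] => s sab;
  rewrite ?oppr_gt0 ltNge; apply/negP => zs; apply: (key s sab).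
  by rewrite ge_min le_max zs (ltW za) orbT.
by rewrite ge_min le_max zs (ltW za) orbT.
Qed.

End path_sign.

Section hitting_time.
Context (Omega : Type) (R : realType) (X : R -> Omega -> R) (g : R -> R).
Local Notation z := (fun w s => g s - X s w).
Hypothesis gc : {within `[0, +oo[, continuous g}.

Lemma hitting_time_ltP w r : (hitting_time X g w < r%:E)%E <->
  exists s, [/\ 0 < s, s < r & g s - X s w = 0].
Proof.
split.
  move=> /ereal_inf_ltP[_ [s [s0 sX] <-]]; rewrite lte_fin => sr; exists s; split => //.
  by rewrite sX subrr.
move=> [s [s0 sr /eqP]]; rewrite subr_eq0 => /eqP gX.
by apply/ereal_inf_ltP; exists s%:E; rewrite ?lte_fin//; exists s.
Qed.

Lemma within_gap w (D : set R) : {within `[0, +oo[, continuous (fun t => X t w)} ->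
  D `<=` `[0, +oo[ -> {within D, continuous (fun s => g s - X s w)}.
Proof.
move=> Xc D0; apply: within_continuousB; exact: continuous_subspaceW D0 _.
Qed.

(** The gap is g 0 at time 0, so a path that avoids the curve keeps that sign. Conversely, absence
    of a zero on [0, t] leaves open that the infimum equals t; the strict sign at t persists a
    little beyond t by continuity, which excludes this. *)
Lemma hitting_time_gtP w (t : R) : X 0 w = 0 -> g 0 != 0 ->
  {within `[0, +oo[, continuous (fun t => X t w)} -> 0 < t ->
  (t%:E < hitting_time X g w)%E <->
  (forall s, s \in `[0, t] -> 0 < Num.sg (g 0) * (g s - X s w)).
Proof.
move=> X0 g0 Xc t0.
have sub (u : R) : `[0, u] `<=` (`[0, +oo[ : set R) by apply: subset_itvl; rewrite bnd_simp.
have zc u : {within `[0, u], continuous (fun s => g s - X s w)}.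
  by apply: within_gap => //; exact: sub.
have in0 (u : R) : 0 <= u -> 0 \in `[0, u] by rewrite in_itv/= lexx.
have sgP (u : R) : 0 <= u -> (forall s, s \in `[0, u] -> g s - X s w != 0) <->
    (forall s, s \in `[0, u] -> 0 < Num.sg (g 0) * (g s - X s w)).
  move=> u0; rewrite path_neq0P//; split.
    move=> [h|h] s su; have := h 0 (in0 _ u0); rewrite X0 subr0 ?oppr_gt0 => g00.
      by rewrite gtr0_sg// mul1r h.
    by rewrite ltr0_sg// mulN1r h.
  move=> h; move: g0; rewrite neq_lt => /orP[g00|g00]; [right|left] => s /h.
    by rewrite ltr0_sg// mulN1r.
  by rewrite gtr0_sg// mul1r.
rewrite -sgP ?ltW//; split.
  move=> tT s; rewrite in_itv/= => /andP[s0 st]; apply/eqP => zs.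
  (* A meeting at time 0 would not count as a hit; it is impossible because the gap there is g 0. *)
  have s00 : 0 < s.
    rewrite lt_neqAle s0 andbT; apply/eqP => s00; move: zs; rewrite -s00 X0 subr0.
    by apply/eqP.
  have : (hitting_time X g w <= s%:E)%E.
    apply: ereal_inf_lbound; exists s => //; split => //.
    by apply/esym/eqP; rewrite -subr_eq0 zs.
  by rewrite leNgt (le_lt_trans _ tT)// lee_fin.
move=> /(sgP _ (ltW t0)) zpos.
have tt : t \in `[0, t] by rewrite in_itv/= ltW//= lexx.
have zt := zpos t tt.
have ztc : (fun s => g s - X s w) @ within `[0, +oo[%classic (nbhs t) --> g t - X t w.
  have /subspace_continuousP := within_gap Xc (@subset_refl _ `[0, +oo[%classic).
  by apply; rewrite /= in_itv/= ltW.
have nz : nbhs (g t - X t w) [set y | 0 < Num.sg (g 0) * y].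
  have : Num.sg (g 0) * (g t - X t w) != 0 by rewrite gt_eqF.
  move: g0; rewrite neq_lt => /orP[g00|g00] _.
    rewrite (_ : [set _ | _] = [set y | y < 0]); last first.
      by apply/seteqP; split => y /=; rewrite ltr0_sg// mulN1r oppr_gt0.
    by apply: lt_nbhsl; move: zt; rewrite ltr0_sg// mulN1r oppr_gt0.
  rewrite (_ : [set _ | _] = [set y | 0 < y]); last first.
    by apply/seteqP; split => y /=; rewrite gtr0_sg// mul1r.
  by apply: lt_nbhsr; move: zt; rewrite gtr0_sg// mul1r.
have := ztc _ nz; rewrite /= withinE /= => -[V /nbhs_ballP[e /= e0 eV] VE].
apply: (@lt_le_trans _ _ (t + e)%:E); first by rewrite lte_fin ltrDl.
apply: le_ereal_inf_tmp => _ [s [s0 sX] <-]; rewrite lee_fin leNgt; apply/negP => ste.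
suff : 0 < Num.sg (g 0) * (g s - X s w) by rewrite sX subrr mulr0 ltxx.
have [st|ts] := leP s t; first by apply: zpos; rewrite in_itv/= ltW.
have : (V `&` `[0, +oo[) s.
  split; last by rewrite /= in_itv/= ltW.
  by apply: eV; rewrite /ball/= ltr0_norm ?subr_lt0// opprB ltrBlDl.
by rewrite -VE => -[].
Qed.

End hitting_time.

(** The event T < r is the union over n of the events that the gap vanishes somewhere in
    [1 / (n + 1), r - 1 / (n + 1)]. Absence of zeros on a compact interval means being positive
    there or negative there, and both are measurable events. *)
Lemma measurable_hitting_time d (Omega : measurableType d) (R : realType)
    (X : R -> Omega -> R) (g : R -> R) :
  (forall s, measurable_fun setT (X s)) ->
  (forall w, {within `[0, +oo[, continuous (fun t => X t w)}) ->
  {within `[0, +oo[, continuous g} ->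
  measurable_fun setT (hitting_time X g).
Proof.
move=> mX cX cg mT; apply: (measurability _ (ErealGenInftyO.measurableE R)) => //.
move=> _ [_ [r ->] <-]; rewrite setTI.
(* The lower end stays away from 0, where a meeting is not a hit; the upper end stays below r, since
   the inequality is strict. *)
pose a n : R := n.+1%:R^-1; pose b n : R := r - n.+1%:R^-1.
pose Z s w := g s - X s w.
pose E n := ~` (positive_paths (a n) (b n) Z `|`
                positive_paths (a n) (b n) (fun s w => - Z s w)).
have a0 n : 0 < a n by rewrite invr_gt0.
have sub n : `[a n, b n] `<=` (`[0, +oo[ : set R).
  by apply: subset_itv; rewrite bnd_simp// ltW.
have mZ s : measurable_fun setT (Z s) by exact: measurable_funB.
have cZ n w : {within `[a n, b n], continuous (fun s => Z s w)}.
  by apply: (within_gap cg) => //.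
rewrite (_ : _ @^-1` _ = \bigcup_(n in [set n | a n < b n]) E n).
  apply: bigcup_measurable => n /= ab; apply: measurableC; apply: measurableU.
    exact: measurable_positive_paths.
  apply: measurable_positive_paths => // [s|w]; first exact: measurableT_comp.
  by move=> x; apply: (@cvgN _ R^o); exact: cZ.
apply/seteqP; split => w /=.
  rewrite in_itv/= => /(hitting_time_ltP _ _ _ _).1[s [s0 sr zs]].
  have e0 : 0 < Num.min (s / 2) ((r - s) / 2).
    by rewrite lt_min !divr_gt0// subr_gt0.
  have [n _ /(_ n (leqnn n)) nP] := near_infty_natSinv_lt (PosNum e0).
  move: nP => /=; rewrite lt_min => /andP[n1 n2].
  have arith (p q : R) : 0 < q -> q < r -> p < q / 2 -> p < (r - q) / 2 ->
      p < r - p /\ p <= q <= r - p.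
    by move=> *; split; [|apply/andP; split]; lra.
  have [ab snab] := arith _ _ s0 sr n1 n2.
  exists n => //; rewrite /E /= => h.
  have := path_neq0P (ltW ab) (cZ n w).
  move=> [_ /(_ h s)]; rewrite in_itv/=.
  by move=> /(_ snab); rewrite /Z zs eqxx.
move=> [n /= ab nE]; rewrite in_itv/=.
apply: contrapT => hT; apply: nE; apply/(path_neq0P (ltW ab) (cZ n w)) => s.
rewrite in_itv/= => /andP[as_ sb]; apply/eqP => zs; apply: hT.
apply/hitting_time_ltP; exists s; split => //; first exact: lt_le_trans as_.
by apply: (le_lt_trans sb); rewrite /b ltrBlDr ltrDl invr_gt0.
Qed.

(** * Time change of curves and of survival events *)

Section time_changed_curve.
Context (R : realType) (beta : R).
Hypothesis beta_gt0 : 0 < beta.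

Lemma bridge_time_ge0 s : 0 <= s -> 0 <= bridge_time beta s.
Proof. by move=> s0; rewrite divr_ge0// ltW// onebt_gt0. Qed.

Lemma continuous_bridge_time s : 0 <= s -> {for s, continuous (bridge_time beta)}.
Proof.
move=> s0; apply: cvgM; first exact: cvg_id.
apply: cvgV; first by rewrite gt_eqF// onebt_gt0.
by apply: cvgD; [exact: cvg_cst|apply: cvgM; [exact: cvg_cst|exact: cvg_id]].
Qed.

Lemma within_bridge_time (h : R -> R) : {within `[0, +oo[, continuous h} ->
  {within `[0, +oo[, continuous (h \o bridge_time beta)}.
Proof.
move=> hc; apply/subspace_continuousP => s s0.
have s00 : 0 <= s by move: s0; rewrite /= in_itv/= andbT.
have vs0 := bridge_time_ge0 s00.
have hcv : h @ within `[0, +oo[%classic (nbhs (bridge_time beta s)) -->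
    h (bridge_time beta s).
  by move/subspace_continuousP : hc; apply; rewrite /= in_itv/= vs0.
apply: cvg_comp hcv => U UV; have := UV; rewrite /= withinE /= => -[V Vn VE].
have nV : nbhs s (bridge_time beta @^-1` V) by exact: continuous_bridge_time s00 _ Vn.
rewrite /= /within/=; apply: filterS nV => r rV; rewrite in_itv/= andbT => r0.
have : (V `&` `[0, +oo[) (bridge_time beta r).
  by split => //; rewrite /= in_itv/= andbT; exact: bridge_time_ge0.
by rewrite -VE => -[].
Qed.

Lemma within_curve_transform (f : R -> R) : {within `[0, +oo[, continuous f} ->
  {within `[0, +oo[, continuous (curve_transform beta f)}.
Proof.
move=> fc; apply/subspace_continuousP => s s0; apply: cvgM.
  apply: cvg_within_filter.
  by apply: cvgD; [exact: cvg_cst|apply: cvgM; [exact: cvg_cst|exact: cvg_id]].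
by move/subspace_continuousP : (within_bridge_time fc); exact.
Qed.

Lemma curve_transform0 (f : R -> R) : curve_transform beta f 0 = f 0.
Proof. by rewrite /curve_transform mulr0 addr0 mul1r mul0r. Qed.

(** The inverse clock is r / (1 - beta r); its denominator is positive because beta v(t) = 1 - 1 /
    (1 + beta t) is below 1. *)
Lemma bridge_time_onto t r : 0 <= t -> 0 <= r <= bridge_time beta t ->
  exists2 s, 0 <= s <= t & r = bridge_time beta s.
Proof.
move=> t0 /andP[r0 rt].
have bt := onebt_gt0 beta_gt0 t0.
have br : 0 < 1 - beta * r.
  have : beta * r <= beta * bridge_time beta t by rewrite ler_pM2l.
  have -> : beta * bridge_time beta t = 1 - (1 + beta * t)^-1.
    by rewrite /bridge_time; field; rewrite gt_eqF.
  have : 0 < (1 + beta * t)^-1 by rewrite invr_gt0.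
  lra.
have s0 : 0 <= r / (1 - beta * r) by rewrite divr_ge0// ltW.
have bs := onebt_gt0 beta_gt0 s0.
have rE : r = bridge_time beta (r / (1 - beta * r)).
  rewrite /bridge_time; field; rewrite gt_eqF//= gt_eqF//; lra.
exists (r / (1 - beta * r)) => //.
rewrite s0/= leNgt; apply/negP => ts.
by have := bridge_time_lt beta_gt0 t0 ts; rewrite -rE ltNge rt.
Qed.

End time_changed_curve.

Section survival.
Context d (Omega : measurableType d) (R : realType) (P : probability Omega R).
Variable X : R -> {RV P >-> R}.
Hypothesis HX : standard_brownian_motion X.
Variables (f : R -> R) (beta : R).
Hypotheses (fc : {within `[0, +oo[, continuous f}) (f0 : f 0 != 0)
  (beta_gt0 : 0 < beta).
Local Notation fb := (curve_transform beta f).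
Local Notation v := (bridge_time beta).
Local Notation T g := (hitting_time X g).

Lemma measurable_gt_hitting_time (g : R -> R) t :
  {within `[0, +oo[, continuous g} ->
  measurable [set w | (t%:E < hitting_time X g w)%E].
Proof.
move=> gc; have [_ Xc _ _] := HX.
have := @measurable_hitting_time _ _ _ X g (fun s => measurable_funPT (X s)) Xc gc.
move=> /(_ measurableT `]t%:E, +oo[%classic); rewrite setTI => h.
have := h (emeasurable_itv _); congr (measurable _).
by apply/seteqP; split => w /=; rewrite in_itv/= andbT.
Qed.

(** Both survival events amount to positivity of a signed gap along [0, t]. Their dyadic versions
    are compared by [brownian_time_change], the constraint [A] on the final value being the test
    function. *)
Lemma survival_time_change t A : 0 < t -> measurable A ->
  P [set w | (t%:E < T fb w)%E /\ A (X t w)] =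
  (\int[P]_(w in [set w | ((v t)%:E < T f w)%E /\ A ((1 + beta * t) * X (v t) w)%R])
     (bridge_density beta t (X (v t) w))%:E)%E.
Proof.
move=> t0 mA; have [X0 Xc _ _] := HX.
have b0 := onebt_gt0 beta_gt0 (ltW t0).
have fbc := within_curve_transform beta_gt0 fc.
pose e := Num.sg (f 0).
pose Z s w := e * (fb s - X s w).
(* The factor 1 + beta s makes the dyadic events of Z and Z' correspond. *)
pose Z' s w := e * ((1 + beta * s) * (f (v s) - X (v s) w)).
pose A' := [set x : R | A ((1 + beta * t) * x)].
have mA' : measurable A'.
  have m : measurable_fun setT (fun x : R => (1 + beta * t) * x) by exact: measurable_funM.
  by have := m measurableT _ mA; rewrite setTI.
have vt0 : 0 < v t by rewrite divr_gt0.
(* The final constraint and the density form one measure [mu'], so that the dyadic limit is taken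
   for measures of events. *)
pose dens w := ((\1_A' (X (v t) w))%:E * (bridge_density beta t (X (v t) w))%:E)%E.
have mdens : measurable_fun setT dens.
  apply: emeasurable_funM; apply/measurable_EFinP.
    exact: (measurableT_comp (measurable_indic mA') (measurable_funPT (X (v t)))).
  exact: (measurableT_comp (measurable_bridge_density beta t) (measurable_funPT (X (v t)))).
have dens0 w : (0 <= dens w)%E.
  by rewrite mule_ge0// lee_fin// bridge_density_ge0.
have [mu' mu'E] := exists_density_measure P mdens dens0.
have mXA : measurable (X t @^-1` A) by exact: measurable_RV_preimage.
have sub : `[0, t] `<=` (`[0, +oo[ : set R) by apply: subset_itvl; rewrite bnd_simp.
have mZ s : measurable_fun setT (Z s).
  by apply: measurable_funM => //; exact: measurable_funB.
have mZ' s : measurable_fun setT (Z' s).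
  by apply: measurable_funM => //; apply: measurable_funM => //; exact: measurable_funB.
have cZ w : {within `[0, t], continuous (fun s => Z s w)}.
  have c := @within_gap Omega R (fun s => X s) fb fbc w _ (Xc w) sub.
  by move=> x; apply: cvgM; [exact: cvg_cst|exact: c].
have cZ' w : {within `[0, t], continuous (fun s => Z' s w)}.
  have c := @within_curve_transform _ _ beta_gt0 (fun s => f s - X s w)
    (@within_gap Omega R (fun s => X s) f fc w _ (Xc w) (@subset_refl _ _)).
  have c' := continuous_subspaceW sub c.
  by move=> x; apply: cvgM; [exact: cvg_cst|exact: c'].
have key : P (positive_paths 0 t Z `&` X t @^-1` A) = mu' (positive_paths 0 t Z').
  rewrite -[LHS]/(mrestr P mXA (positive_paths 0 t Z)).
  apply: eq_measure_positive_paths => //.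
  - by rewrite ltey_eq fin_num_measure.
  (* The density is at most sqrt (1 + beta t), so [mu'] is finite. *)
  - rewrite mu'E; apply: (@le_lt_trans _ _
      (\int[P]_w (Num.sqrt (1 + beta * t))%:E)%E); last first.
      by rewrite integral_cst//= probability_setT mule1 ltry.
    apply: ge0_le_integral => //.
    move=> w _; rewrite /dens -EFinM lee_fin.
    apply: (@le_trans _ _ (1 * bridge_density beta t (X (v t) w))).
      apply: ler_wpM2r; first exact: bridge_density_ge0.
      by rewrite indicE; case: (_ \in _).
    rewrite mul1r /bridge_density ler_piMr ?sqrtr_ge0//.
    rewrite expR_le1 oppr_le0; apply: divr_ge0 => //.
    by apply: mulr_ge0; [apply: mulr_ge0; exact: ltW|exact: sqr_ge0].
  - move=> m k; rewrite mu'E /= /mrestr.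
    pose tt i := dyadic 0 t k i.
    pose B i := [set y : R | m.+1%:R^-1 <= e * ((1 + beta * tt i) * (f (v (tt i)) - y))].
    have tt0 : tt 0%N = 0 by rewrite /tt /dyadic mul0r mulr0 addr0.
    have ttS i : tt i < tt i.+1.
      have k0 : 0 < (2 ^+ k)^-1 :> R by rewrite invr_gt0 exprn_gt0.
      by rewrite /tt /dyadic ltrD2l subr0 ltr_pM2l// (ltr_pM2r k0) ltr_nat.
    (* The last dyadic time is t itself, so the density is evaluated at time v t. *)
    have ttE : tt (2 ^ k)%N = t.
      by rewrite /tt /dyadic natrX divff ?expf_neq0// mulr1; lra.
    have mB i : measurable (B i).
      have m1 : measurable_fun setT
          (fun y : R => e * ((1 + beta * tt i) * (f (v (tt i)) - y))).
        apply: measurable_funM => //; apply: measurable_funM => //.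
        exact: measurable_funB.
      have := m1 measurableT `[m.+1%:R^-1, +oo[%classic (measurable_itv _).
      rewrite setTI; congr (measurable _).
      by apply/seteqP; split => y /=; rewrite in_itv/= andbT.
    have := brownian_time_change beta_gt0 HX (2 ^ k) tt0 ttS mB
      (phi := fun x => (\1_A' x)%:E).
    move=> /(_ _ _)/=; rewrite ttE => btc.
    have -> : dyadic_event 0 t Z' m k = cylinder X (fun i => v (tt i)) (2 ^ k) B.
      apply: eq_bigcapr => i _; apply/seteqP; split => w;
      by rewrite /= in_itv/= andbT.
    rewrite -btc; last 2 first.
    - exact/measurable_EFinP/measurable_indic.
    - by move=> x; rewrite lee_fin.
    have -> : dyadic_event 0 t Z m k =
        cylinder X tt (2 ^ k) (fun i => [set x : R | B i (x / (1 + beta * tt i))%R]).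
      apply: eq_bigcapr => i _; apply/seteqP; split => w;
      rewrite /= in_itv/= andbT /B /= /Z /curve_transform -/(v _) -/(tt i);
      have -> // : (1 + beta * tt i) * (f (v (tt i)) - X (tt i) w / (1 + beta * tt i)) =
        (1 + beta * tt i) * f (v (tt i)) - X (tt i) w.
        have : 0 < 1 + beta * tt i.
          apply: onebt_gt0 => //; rewrite /tt /dyadic add0r subr0.
          by rewrite mulr_ge0 ?divr_ge0 ?exprn_ge0// ltW.
        by move=> bt; field; rewrite gt_eqF.
      have : 0 < 1 + beta * tt i.
        apply: onebt_gt0 => //; rewrite /tt /dyadic add0r subr0.
        by rewrite mulr_ge0 ?divr_ge0 ?exprn_ge0// ltW.
      by move=> bt; field; rewrite gt_eqF.
    set D := cylinder _ _ _ _.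
    have mD : measurable D.
      apply: measurable_cylinder => i.
      have m1 : measurable_fun setT (fun x : R => x / (1 + beta * tt i)).
        exact: measurable_funM.
      by have := m1 measurableT _ (mB i); rewrite setTI.
    rewrite setIC -integral_indic//; apply: eq_integral => w _.
    congr EFin; rewrite !indicE; congr (nat_of_bool _)%:R.
    by apply/idP/idP; rewrite !inE /A'/= mulrC divfK// gt_eqF.
have hitP (g : R -> R) (u : R) : 0 < u -> {within `[0, +oo[, continuous g} -> g 0 = f 0 ->
    {ae P, forall w, (u%:E < T g w)%E <->
      (forall s, s \in `[0, u] -> 0 < e * (g s - X s w))}.
  move=> u0 gc g0; apply: filterS X0 => w X0w.
  have g00 : g 0 != 0 by rewrite g0.
  have := @hitting_time_gtP Omega R (fun s => X s) g gc w u X0w g00 (Xc w) u0.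
  by rewrite g0.
rewrite (_ : P _ = P (positive_paths 0 t Z `&` X t @^-1` A)); last first.
  apply: eq_measure_ae.
  - apply: measurableI => //; exact: measurable_gt_hitting_time.
  - by apply: measurableI => //; exact: measurable_positive_paths.
  - have := hitP _ _ t0 fbc (curve_transform0 beta f).
    by apply: filterS => w [h1 h2]; split => -[H1 H2]; split => //; [exact: h1|exact: h2].
rewrite key mu'E [LHS]integral_mkcond [RHS]integral_mkcond.
have mS : measurable [set w | ((v t)%:E < T f w)%E /\ A ((1 + beta * t) * X (v t) w)%R].
  apply: measurableI; first exact: measurable_gt_hitting_time.
  exact: (measurable_RV_preimage _ mA').
have mpos : measurable (positive_paths 0 t Z') by exact: measurable_positive_paths.
apply: ge0_ae_eq_integral => //.
- by apply/(measurable_restrictT _ mpos); exact: measurable_funTS.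
- apply/(measurable_restrictT _ mS); apply: measurable_funTS.
  apply/measurable_EFinP.
  exact: (measurableT_comp (measurable_bridge_density beta t) (measurable_funPT (X (v t)))).
- by move=> w _; apply: erestrict_ge0.
- by move=> w _; apply: erestrict_ge0 => w' _; rewrite lee_fin bridge_density_ge0.
have := hitP _ _ vt0 fc erefl.
apply: filterS => w hw _; rewrite !patchE.
(* The clock maps [0, t] onto [0, v t], and the positive factor 1 + beta s does not affect the sign
   of the gap. *)
have posE : positive_paths 0 t Z' w <-> ((v t)%:E < T f w)%E.
  rewrite hw; split => H s.
    rewrite in_itv/= => /(bridge_time_onto beta_gt0 (ltW t0))[r rt ->].
    have br : 0 < 1 + beta * r by apply: onebt_gt0 => //; case/andP: rt.
    by have := H r; rewrite in_itv/= => /(_ rt); rewrite /Z' mulrCA (pmulr_rgt0 _ br).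
  rewrite in_itv/= => /andP[s0 st]; rewrite /Z' mulrCA.
  apply: mulr_gt0; first exact: onebt_gt0.
  apply: H; rewrite in_itv/= bridge_time_ge0//=.
  move: st; rewrite le_eqVlt => /predU1P[->//|st].
  exact/ltW/bridge_time_lt.
have [posw|posw] := pselect (positive_paths 0 t Z' w); last first.
  by rewrite (memNset posw) memNset// => -[/posE].
rewrite mem_set// /dens indicE.
have [Aw|Aw] := pselect (A ((1 + beta * t) * X (v t) w)).
  by rewrite !mem_set ?mul1e//; split => //; exact/posE.
by rewrite !memNset ?mul0e// => -[].
Qed.

End survival.

(** * Images kernels *)

Section images.
Context (R : realType).
Local Notation mu := (@lebesgue_measure R).
Implicit Type F : {measure set (measurableTypeR R) -> \bar R}.
Local Notation itv0y := (`]0%R, +oo[%classic : set (measurableTypeR R)).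

Definition gauss_integrable F := forall eps, 0 < eps ->
  (\int[F]_(s in `]0%R, +oo[) (expR (- (eps * s ^+ 2 / 2)))%:E < +oo)%E.

Definition images_integral F t x : \bar R :=
  (\int[F]_(s in `]0%R, +oo[) (expR (- ((x - s) ^+ 2 / (2 * t))))%:E)%E.

Lemma measurable_gauss (c : R) : measurable_fun (setT : set (measurableTypeR R))
  (fun s : R => expR (- (c * s ^+ 2 / 2))).
Proof.
apply: measurableT_comp => //; apply: measurableT_comp => //.
by apply: measurable_funM => //; apply: measurable_funM.
Qed.

Lemma measurable_gauss_shift (t x : R) :
  measurable_fun (setT : set (measurableTypeR R)) (fun s : R => expR (- ((x - s) ^+ 2 / (2 * t)))).
Proof.
apply: measurableT_comp => //; apply: measurableT_comp => //.
by apply: measurable_funM => //; apply: measurable_funX; exact: measurable_funB.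
Qed.

(** The two exponents differ by the square (2 x - s)^2 / (4 t). A shifted Gaussian in [s] is thus
    dominated by a centred one, of the kind that F integrates. *)
Lemma gauss_shift_le (t x s : R) : 0 < t ->
  expR (- ((x - s) ^+ 2 / (2 * t))) <=
  expR (x ^+ 2 / (2 * t)) * expR (- ((2 * t)^-1 * s ^+ 2 / 2)).
Proof.
move=> t0; rewrite -expRD ler_expR -subr_ge0.
have -> : x ^+ 2 / (2 * t) - (2 * t)^-1 * s ^+ 2 / 2 - - ((x - s) ^+ 2 / (2 * t)) =
   (2 * x - s) ^+ 2 / (4 * t).
  by field; rewrite gt_eqF.
by rewrite divr_ge0 ?sqr_ge0// mulr_ge0// ltW.
Qed.

Lemma images_integral_fin F t x : gauss_integrable F -> 0 < t ->
  images_integral F t x \is a fin_num.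
Proof.
move=> Fint t0; rewrite ge0_fin_numE; last first.
  by apply: integral_ge0 => s _; rewrite lee_fin expR_ge0.
apply: (@le_lt_trans _ _ (\int[F]_(s in `]0%R, +oo[)
    ((expR (x ^+ 2 / (2 * t)))%:E * (expR (- ((2 * t)^-1 * s ^+ 2 / 2)))%:E))%E).
  apply: ge0_le_integral => //=.
  - by apply/measurable_EFinP; apply: measurable_funTS; exact: measurable_gauss_shift.
  - apply: emeasurable_funM => //.
    by apply/measurable_EFinP; apply: measurable_funTS; exact: measurable_gauss.
  - by move=> s _; rewrite -EFinM lee_fin gauss_shift_le.
rewrite ge0_integralZl//.
- rewrite lte_mul_pinfty ?lee_fin ?expR_ge0//; apply: (Fint (2 * t)^-1).
  by rewrite invr_gt0 mulr_gt0.
- by apply/measurable_EFinP; apply: measurable_funTS; exact: measurable_gauss.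
Qed.

(** Multiplied by exp (x^2 / (2 t)), the integral at x becomes int exp (x s / t - s^2 / (2 t))
    F(ds), which is nondecreasing in x because s > 0. *)
Lemma images_integral_le F t x y : 0 < t -> x <= y ->
  (images_integral F t x <=
   (expR ((y ^+ 2 - x ^+ 2) / (2 * t)))%:E * images_integral F t y)%E.
Proof.
move=> t0 xy; rewrite -ge0_integralZl//; last first.
  by apply/measurable_EFinP; apply: measurable_funTS; exact: measurable_gauss_shift.
apply: ge0_le_integral => //=.
- by apply/measurable_EFinP; apply: measurable_funTS; exact: measurable_gauss_shift.
- apply: emeasurable_funM => //.
  by apply/measurable_EFinP; apply: measurable_funTS; exact: measurable_gauss_shift.
move=> s; rewrite in_itv/= andbT => s0.
rewrite -EFinM lee_fin -expRD ler_expR -subr_ge0.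
have -> : (y ^+ 2 - x ^+ 2) / (2 * t) - (y - s) ^+ 2 / (2 * t) - - ((x - s) ^+ 2 / (2 * t)) =
   (y - x) * s / t.
  by field; rewrite gt_eqF.
by rewrite divr_ge0 ?mulr_ge0 ?subr_ge0// ltW.
Qed.

Lemma images_kernel_eq0 F t x : 0 < t ->
  (images_kernel F t x = 0%E) <-> (images_gap F t x = 0%E).
Proof.
move=> t0; have c0 : 0 < (Num.sqrt (2 * pi * t))^-1.
  by rewrite invr_gt0 sqrtr_gt0 !mulr_gt0// pi_gt0.
rewrite /images_kernel; split => [/eqP|->]; last by rewrite mule0.
by rewrite mule_eq0 eqe gt_eqF//= => /eqP.
Qed.

Lemma images_gap_eq0 F t x :
  (images_gap F t x = 0%E) <-> images_integral F t x = (expR (- (x ^+ 2 / (2 * t))))%:E.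
Proof.
rewrite /images_gap -/(images_integral F t x); split => [/eqP|->]; last by rewrite subee.
by rewrite sube_eq ?add0e ?fin_num_adde_defr// => /eqP.
Qed.

Lemma images_kernel_fin F t x : gauss_integrable F -> 0 < t ->
  images_kernel F t x \is a fin_num.
Proof.
move=> Fint t0; rewrite fin_numM// fin_numB; apply/andP; split => //.
exact: images_integral_fin.
Qed.

(** By [images_integral_le], the ratio of the image term to exp (- x^2 / (2 t)) is nondecreasing in
    x. It equals 1 at a root [y], hence is at most 1 to the left of it. *)
Lemma images_kernel_ge0 F t x y : 0 < t -> x <= y -> images_gap F t y = 0%E ->
  (0 <= images_kernel F t x)%E.
Proof.
move=> t0 xy /images_gap_eq0 yE; rewrite mule_ge0 ?lee_fin ?invr_ge0 ?sqrtr_ge0//.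
rewrite sube_ge0 ?orbT//; apply: le_trans (images_integral_le F t0 xy) _.
rewrite yE -EFinM -expRD.
have -> : (y ^+ 2 - x ^+ 2) / (2 * t) - y ^+ 2 / (2 * t) = - (x ^+ 2 / (2 * t)).
  by field; rewrite gt_eqF.
exact: lexx.
Qed.

Lemma integral_tilt F (beta : R) (phi : R -> R) :
  measurable_fun (setT : set (measurableTypeR R)) phi -> (forall s, 0 < s -> 0 <= phi s) ->
  (\int[tilt beta F]_(s in `]0%R, +oo[) (phi s)%:E =
   \int[F]_(s in `]0%R, +oo[) (phi s * expR (- (beta * s ^+ 2 / 2)))%:E)%E.
Proof.
move=> mphi phi0; rewrite (@ge0_integral_density _ _ _ F (tilt beta F) itv0y
  (fun s => expR (- (beta * s ^+ 2 / 2))) (EFin \o phi))//.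
- by apply: measurable_funTS; exact: measurable_gauss.
- by apply/measurable_EFinP; exact: measurable_funTS.
- by move=> s; rewrite /= in_itv/= andbT lee_fin => /phi0.
Qed.

Lemma images_integral_tilt F beta t x :
  images_integral (tilt beta F) t x =
  (\int[F]_(s in `]0%R, +oo[) (expR (- ((x - s) ^+ 2 / (2 * t)))
                * expR (- (beta * s ^+ 2 / 2)))%:E)%E.
Proof.
apply: integral_tilt; first exact: measurable_gauss_shift.
by move=> s _; exact: expR_ge0.
Qed.

Lemma tilt_le F beta A : 0 < beta -> measurable A -> (tilt beta F A <= F A)%E.
Proof.
move=> b0 mA; rewrite /tilt -[leRHS]mul1e -integral_cst//.
apply: ge0_le_integral => //=.
- by apply/measurable_EFinP; apply: measurable_funTS; exact: measurable_gauss.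
- move=> s _; rewrite lee_fin expR_le1 oppr_le0 divr_ge0//.
  by rewrite mulr_ge0 ?sqr_ge0// ltW.
Qed.

Lemma sigma_finite_tilt F beta : 0 < beta -> sigma_finite itv0y F ->
  sigma_finite itv0y (tilt beta F).
Proof.
move=> b0 [G GE Gfin]; exists G => // n; have [mG Foo] := Gfin n.
by split => //; exact: le_lt_trans (tilt_le _ b0 mG) Foo.
Qed.

Lemma gauss_integrable_tilt F beta : 0 < beta -> gauss_integrable F ->
  gauss_integrable (tilt beta F).
Proof.
move=> b0 Fint eps eps0; apply: le_lt_trans (Fint _ eps0).
rewrite integral_tilt; [|exact: measurable_gauss|by move=> s _; exact: expR_ge0].
apply: ge0_le_integral => //=.
- apply/measurable_EFinP/measurable_funTS.
  by apply: measurable_funM; exact: measurable_gauss.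
- by apply/measurable_EFinP; apply: measurable_funTS; exact: measurable_gauss.
- move=> s _; rewrite lee_fin ler_piMr ?expR_ge0// expR_le1 oppr_le0 divr_ge0//.
  by rewrite mulr_ge0 ?sqr_ge0// ltW.
Qed.

(* F need only be sigma-finite on ]0, +oo[, whereas Fubini's theorem asks for
   sigma-finiteness on the whole line. *)
Lemma restrict_sigma_finite F : sigma_finite itv0y F ->
  exists2 F0 : {sigma_finite_measure set (measurableTypeR R) -> \bar R},
    F0 = mrestr F (measurable_itv `]0, +oo[) :> (set (measurableTypeR R) -> \bar R) &
    forall phi : R -> \bar R, measurable_fun (setT : set (measurableTypeR R)) phi ->
      (forall s, 0 <= phi s)%E ->
      (\int[F0]_s phi s = \int[F]_(s in `]0%R, +oo[) phi s)%E.
Proof.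
move=> [G GE Gfin].
have sF : sigma_finite setT (mrestr F (measurable_itv `]0, +oo[)).
  exists (fun n => if n is m.+1 then G m else ~` itv0y).
    apply/esym; rewrite -subTset => s _.
    have [sG|sG] := pselect (itv0y s); last by exists 0%N.
    by move: sG; rewrite GE => -[n _ Gn]; exists n.+1.
  case=> [|n].
    split; first exact: measurableC.
    by rewrite /mrestr setICl measure0.
  have [mG Foo] := Gfin n; split => //; apply: le_lt_trans Foo.
  by rewrite /mrestr le_measure// inE//; exact: measurableI.
have [F0 F0E] := exists_sigma_finite_measure sF.
exists F0 => // phi mphi phi0.
rewrite (eq_measure_integral (mrestr F (measurable_itv `]0, +oo[))); last first.
  by move=> A mA _; exact: (congr1 (fun m => m A) F0E).
exact: ge0_integral_mrestr.
Qed.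

Lemma measurable_images_kernel F t : sigma_finite itv0y F ->
  measurable_fun (setT : set (measurableTypeR R)) (images_kernel F t).
Proof.
move=> /restrict_sigma_finite[F0 F0E F0I].
pose g (p : measurableTypeR R * measurableTypeR R) : \bar R :=
  (expR (- ((p.1 - p.2) ^+ 2 / (2 * t))))%:E.
have mg : measurable_fun setT g.
  apply/measurable_EFinP; apply: measurableT_comp => //; apply: measurableT_comp => //.
  by apply: measurable_funM => //; apply: measurable_funX; exact: measurable_funB.
have mI : measurable_fun (setT : set (measurableTypeR R)) (images_integral F t).
  have := @measurable_fun_fubini_tonelli_F _ _ _ _ _ F0 g mg _.
  rewrite (_ : fubini_F F0 g = images_integral F t); first by apply => p; rewrite lee_fin expR_ge0.
  apply/funext => x; rewrite /fubini_F /g /=.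
  rewrite (F0I (fun s => (expR (- ((x - s) ^+ 2 / (2 * t))))%:E))//.
  by apply/measurable_EFinP; exact: measurable_gauss_shift.
apply: emeasurable_funM => //; apply: emeasurable_funB => //.
apply/measurable_EFinP; have := @measurable_gauss (t^-1); congr (measurable_fun _ _).
by apply/funext => x; congr expR; rewrite invfM; lra.
Qed.

Section transformed_kernel.
Variables (F : {measure set (measurableTypeR R) -> \bar R}) (beta t : R).
Hypotheses (beta_gt0 : 0 < beta) (t_gt0 : 0 < t) (Fint : gauss_integrable F).
Local Notation v := (bridge_time beta).

(** For every s, ((1 + beta t) x - s)^2 / (2 t) + beta s^2 / 2 = beta (1 + beta t) x^2 / 2 + (x -
    s)^2 / (2 v t). The case s = 0 is the first term of the gap, and the factor common to all s
    leaves the integral. *)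
Lemma images_gap_tilt x :
  images_gap (tilt beta F) t ((1 + beta * t) * x) =
  ((expR (- (beta * (1 + beta * t) * x ^+ 2 / 2)))%:E * images_gap F (v t) x)%E.
Proof.
have b0 := onebt_gt0 beta_gt0 (ltW t_gt0).
have vt0 : 0 < v t by rewrite divr_gt0.
rewrite /images_gap -!/(images_integral _ _ _) muleBr//.
rewrite -EFinM -expRD images_integral_tilt -ge0_integralZl//; last first.
  by apply/measurable_EFinP; apply: measurable_funTS; exact: measurable_gauss_shift.
rewrite /bridge_time; congr (_%:E - _)%E.
  by congr expR; field; rewrite !gt_eqF.
apply: eq_integral => s _; rewrite -EFinM -!expRD; congr (expR _)%:E.
by field; rewrite !gt_eqF.
Qed.

(** 1 + beta t is the Jacobian of the scaling of x. One square root of it is the ratio sqrt (t / v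
    t) of normalizing constants, the other the prefactor of [bridge_density]. *)
Lemma images_kernel_tilt x :
  ((1 + beta * t)%:E * images_kernel (tilt beta F) t ((1 + beta * t) * x)%R =
  (bridge_density beta t x)%:E * images_kernel F (v t) x)%E.
Proof.
have b0 := onebt_gt0 beta_gt0 (ltW t_gt0).
rewrite /images_kernel images_gap_tilt /bridge_density !muleA -!EFinM.
have pit : 0 < 2 * pi * t by rewrite !mulr_gt0// pi_gt0.
have -> : Num.sqrt (2 * pi * v t) = Num.sqrt (2 * pi * t) / Num.sqrt (1 + beta * t).
  by rewrite /bridge_time mulrA (sqrtrM _ (ltW pit)) sqrtrV// ltW.
have sb : Num.sqrt (1 + beta * t) != 0 by rewrite gt_eqF// sqrtr_gt0.
have st : Num.sqrt (2 * pi * t) != 0 by rewrite gt_eqF// sqrtr_gt0.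
congr (_%:E * _)%E; rewrite -{1}(sqr_sqrtr (ltW b0)).
by field; rewrite st sb.
Qed.

End transformed_kernel.

End images.

(** * Images representation of the transformed curve *)

Section images_curve_transform.
Context d (Omega : measurableType d) (R : realType) (P : probability Omega R).
Variable X : R -> {RV P >-> R}.
Hypothesis HX : standard_brownian_motion X.
Variables (f : R -> R) (beta : R).
Variable F : {measure set (measurableTypeR R) -> \bar R}.
Hypotheses (fc : {within `[0, +oo[, continuous f}) (f0 : f 0 != 0)
  (beta_gt0 : 0 < beta) (fF : obtained_by_images X f F).
Local Notation fb := (curve_transform beta f).
Local Notation v := (bridge_time beta).
Local Notation mu := (@lebesgue_measure R).

Let Fint : gauss_integrable F. Proof. by case: fF. Qed.

Lemma curve_transformE t : fb t = (1 + beta * t) * f (v t).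
Proof. by []. Qed.

Lemma unique_root_curve_transform t : 0 < t ->
  unique (fun x => images_kernel (tilt beta F) t x = 0%E) (fb t).
Proof.
move=> t0; have [_ _ uniqF _] := fF.
have b0 := onebt_gt0 beta_gt0 (ltW t0).
have vt0 : 0 < v t by rewrite divr_gt0.
have e0 x : expR (- (beta * (1 + beta * t) * x ^+ 2 / 2)) != 0 by rewrite gt_eqF// expR_gt0.
have rootE x : (images_kernel (tilt beta F) t ((1 + beta * t) * x) = 0%E) <->
    (images_kernel F (v t) x = 0%E).
  rewrite !images_kernel_eq0// images_gap_tilt//; split => [/eqP|->]; last by rewrite mule0.
  by rewrite mule_eq0 eqe (negbTE (e0 x))/= => /eqP.
have [r1 r2] := uniqF _ vt0; split; first exact/rootE.
move=> x; have -> : x = (1 + beta * t) * (x / (1 + beta * t)) by field; rewrite gt_eqF.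
by move=> /rootE /r2 <-.
Qed.

(** On the survival event of f, the law of X (v t) has the images kernel of F as its density below f
    (v t). Multiplied by [bridge_density] and scaled by 1 + beta t, this kernel becomes the tilted
    one. *)
Lemma survival_curve_transform t (A : set R) : 0 < t -> measurable A ->
  A `<=` `]-oo, fb t] ->
  P [set w | (t%:E < hitting_time X fb w)%E /\ A (X t w)] =
  (\int[mu]_(x in A) images_kernel (tilt beta F) t x)%E.
Proof.
move=> t0 mA Afb; have [sF _ uniqF law] := fF.
have b0 := onebt_gt0 beta_gt0 (ltW t0).
have vt0 : 0 < v t by rewrite divr_gt0.
pose A' := [set x : R | A ((1 + beta * t) * x)].
have mA' : measurable A'.
  have m : measurable_fun setT (fun x : R => (1 + beta * t) * x) by exact: measurable_funM.
  by have := m measurableT _ mA; rewrite setTI.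
have A'f : A' `<=` `]-oo, f (v t)].
  by move=> x /Afb; rewrite /= !in_itv/= curve_transformE ler_pM2l.
have gap0 : images_gap F (v t) (f (v t)) = 0%E.
  by have [/images_kernel_eq0 + _] := uniqF _ vt0; exact.
have kge0 x : A' x -> (0 <= images_kernel F (v t) x)%E.
  move=> /A'f; rewrite /= in_itv/= => xf; exact: images_kernel_ge0 xf gap0.
have kfin x := images_kernel_fin x Fint vt0.
rewrite survival_time_change//.
set S := [set w | _].
have mS : measurable S.
  apply: measurableI; first exact: measurable_gt_hitting_time.
  exact: (measurable_RV_preimage _ mA').
have mL : measurable_fun (setT : set (measurableTypeR R))
    (fun x => (bridge_density beta t x)%:E : \bar R).
  by apply/measurable_EFinP; exact: measurable_bridge_density.
have [nu nuE nuI] := @exists_pushforward _ _ Omega (measurableTypeR R) R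
  (mrestr P mS) (X (v t)) (measurable_funPT (X (v t))).
have L0 x : (0 <= (bridge_density beta t x)%:E)%E by rewrite lee_fin bridge_density_ge0.
transitivity (\int[nu]_x (bridge_density beta t x)%:E)%E.
  rewrite nuI// ge0_integral_mrestr//.
  by apply/measurable_EFinP; apply: measurableT_comp => //; exact: measurable_bridge_density.
(* Cut off to [A']: the kernel is known to be nonnegative, and to be a density, only to the left of
   the root f (v t). *)
pose k x := fine (images_kernel F (v t) x) * \1_A' x.
have kE x : A' x -> (k x)%:E = images_kernel F (v t) x.
  by move=> xA; rewrite /k indicE mem_set// mulr1 fineK.
have k0 x : ~ A' x -> k x = 0.
  by move=> xA; rewrite /k indicE memNset// mulr0.
rewrite (@ge0_integral_density _ _ _ mu nu setT k)//; first last.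
- move=> B mB _; have mBA : measurable (B `&` A') by exact: measurableI.
  transitivity (P [set w | ((v t)%:E < hitting_time X f w)%E /\ (B `&` A') (X (v t) w)]).
    rewrite nuE; congr (P _).
    by apply/seteqP; split => w /=; [move=> [? [? ?]]|move=> [? [? ?]]].
  rewrite law//; last by move=> x [_ /A'f].
  rewrite integral_mkcondr; apply: eq_integral => x _.
  rewrite patchE; case: ifPn => [|xA]; first by rewrite inE => /kE.
  by rewrite k0//; move: xA; rewrite notin_setE.
- move=> x _; rewrite lee_fin; have [xA|/k0->//] := pselect (A' x).
  by rewrite -lee_fin kE// kge0.
- apply: measurable_funM; last exact: measurable_indic.
  by apply: measurableT_comp => //; exact: measurable_images_kernel.
pose K := images_kernel (tilt beta F) t.
have KE x : A' x -> ((1 + beta * t)%:E * K ((1 + beta * t) * x)%R =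
    (bridge_density beta t x)%:E * (k x)%:E)%E.
  by move=> xA; rewrite kE// /K images_kernel_tilt.
have mK : measurable_fun (setT : set (measurableTypeR R)) (K \_ A).
  apply/(measurable_restrictT _ mA); apply: measurable_funTS.
  apply: measurable_images_kernel; exact: sigma_finite_tilt.
have maff : measurable_fun setT
    (fun x : measurableTypeR R => ((1 + beta * t) * (x : R) + 0 : measurableTypeR R)).
  by apply: measurable_funD => //; exact: measurable_funM.
have KA0 x : (0 <= (K \_ A) x)%E.
  apply: erestrict_ge0 => {}x /Afb; rewrite /= in_itv/= => xfb.
  have [K0 _] := unique_root_curve_transform t0.
  by apply: images_kernel_ge0 xfb _ => //; exact/images_kernel_eq0.
rewrite [RHS]integral_mkcond [RHS](ge0_integral_lebesgue_affine 0 b0)//.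
rewrite -ge0_integralZl//; last 3 first.
- exact: (measurableT_comp mK maff).
- by move=> x _; exact: KA0.
- by rewrite lee_fin ltW.
apply: eq_integral => x _; rewrite addr0 patchE.
case: ifPn => [|xA]; first by rewrite inE => xA; rewrite KE.
by rewrite k0 ?mule0//; move: xA; rewrite notin_setE.
Qed.

Lemma obtained_by_images_curve_transform : obtained_by_images X fb (tilt beta F).
Proof.
have [sF _ _ _] := fF; split.
- exact: sigma_finite_tilt.
- exact: gauss_integrable_tilt.
- exact: unique_root_curve_transform.
- by move=> t t0 A mA Afb; exact: survival_curve_transform.
Qed.

End images_curve_transform.

(** * First-passage density *)

Section gaussian_cdf.
Context (R : realType).
Local Notation mu := (@lebesgue_measure R).

Definition gauss_cdf (y : R) : R :=
  (\int[mu]_(x in `]-oo, y]) normal_pdf 0 1 x)%R.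

Lemma is_derive_gauss_cdf (y : R) : is_derive y 1 gauss_cdf (normal_pdf 0 1 y).
Proof.
have [] := @continuous_FTC1 R (normal_pdf 0 1) (BInfty _ true) y (y + 1).
- by rewrite ltrDl.
- apply: (@integrableS _ _ _ _ setT) => //; exact: integrable_normal_pdf.
- by rewrite ltNyr.
- exact: continuous_normal_pdf.
by move=> h1 h2; apply: DeriveDef; [exact: h1|rewrite -derive1E; exact: h2].
Qed.

Lemma normal_pdf01E (y : R) :
  normal_pdf 0 1 y = (Num.sqrt (2 * pi))^-1 * expR (- (y ^+ 2 / 2)).
Proof.
rewrite normal_pdfE//= /normal_peak /normal_fun expr1n mul1r subr0.
by rewrite mulr2n -mulr2n -(mulr_natl pi) mulNr.
Qed.

Lemma normal_pdf_scaled (t x : R) : 0 < t ->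
  (Num.sqrt (2 * pi * t))^-1 * expR (- (x ^+ 2 / (2 * t))) =
  (Num.sqrt t)^-1 * normal_pdf 0 1 (x / Num.sqrt t).
Proof.
move=> t0; rewrite normal_pdf01E exprMn exprVn sqr_sqrtr ?ltW//.
have p0 : 0 < 2 * pi :> R by rewrite mulr_gt0// pi_gt0.
rewrite sqrtrM ?ltW// invfM [in RHS]mulrA [X in X * _ = _]mulrC.
by congr (_ * expR (- _)); rewrite invfM mulrACA [RHS]mulrAC -mulrA; lra.
Qed.

Lemma gauss_cdfE (y : R) :
  (gauss_cdf y)%:E = (\int[mu]_(x in `]-oo, y]) (normal_pdf 0 1 x)%:E)%E.
Proof.
rewrite /gauss_cdf /Rintegral fineK//.
apply: integrable_fin_num => //=.
apply: (@integrableS _ _ _ _ setT) => //; exact: integrable_normal_pdf.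
Qed.

Lemma gauss_cdf_ge0 (y : R) : 0 <= gauss_cdf y.
Proof.
rewrite -lee_fin gauss_cdfE integral_ge0// => x _.
by rewrite lee_fin normal_pdf_ge0.
Qed.

Lemma integral_gauss_kernel (t y s : R) : 0 < t ->
  (\int[mu]_(x in `]-oo, y])
     ((Num.sqrt (2 * pi * t))^-1 * expR (- ((x - s) ^+ 2 / (2 * t))))%:E =
   (gauss_cdf ((y - s) / Num.sqrt t))%:E)%E.
Proof.
move=> t0; have st : 0 < Num.sqrt t by rewrite sqrtr_gt0.
under eq_integral do rewrite normal_pdf_scaled//.
rewrite gauss_cdfE.
pose h (x : R) : \bar R := ((Num.sqrt t)^-1 * normal_pdf 0 1 ((x - s) / Num.sqrt t))%:E.
have mh : measurable_fun (setT : set (measurableTypeR R)) (h \_ `]-oo, y]).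
  apply/(measurable_restrictT _ (measurable_itv _)); apply: measurable_funTS.
  apply/measurable_EFinP; apply: measurable_funM => //.
  apply: (@measurableT_comp _ _ _ _ _ _ (normal_pdf 0 1)).
    exact: measurable_normal_pdf.
  by apply: measurable_funM => //; exact: measurable_funB.
have h0 x : (0 <= (h \_ `]-oo, y]) x)%E.
  apply: erestrict_ge0 => {}x _.
  by rewrite lee_fin mulr_ge0 ?invr_ge0 ?sqrtr_ge0// normal_pdf_ge0.
have maff : measurable_fun setT
    (fun x : measurableTypeR R => (Num.sqrt t * (x : R) + s : measurableTypeR R)).
  by apply: measurable_funD => //; exact: measurable_funM.
rewrite integral_mkcond (ge0_integral_lebesgue_affine s st)//.
rewrite -ge0_integralZl//; last exact: (measurableT_comp mh maff).
rewrite [RHS]integral_mkcond; apply: eq_integral => x _; rewrite !patchE.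
have -> : (Num.sqrt t * x + s \in `]-oo, y]%classic) = (x \in `]-oo, (y - s) / Num.sqrt t]%classic).
  by apply/idP/idP; rewrite !inE /= !in_itv/= ler_pdivlMr// [x * _]mulrC -lerBrDr.
case: ifPn => _; last by rewrite mule0.
rewrite -EFinM mulrA divff ?gt_eqF// mul1r; congr (normal_pdf _ _ _)%:E.
by field; rewrite gt_eqF.
Qed.

End gaussian_cdf.

(** * Time derivative of the Gaussian terms *)

Section first_passage_calculus.
Context (R : realType) (g g' : R -> R).
Hypothesis gd : forall t : R, 0 < t -> is_derive t 1 g (g' t).
Hypothesis g'c : forall t : R, 0 < t -> {for t, continuous g'}.
Local Notation mu := (@lebesgue_measure R).

(** The t-derivative of (g t - s) / sqrt t is affine in s, with constant term [drift] and
    coefficient [slope]. Keeping them apart isolates the part that cancels after integration over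
    s. *)
Definition drift t := g' t / Num.sqrt t - g t / (2 * t * Num.sqrt t).
Definition slope t : R := (2 * t * Num.sqrt t)^-1.
Definition cdf_rate s t :=
  normal_pdf 0 1 ((g t - s) / Num.sqrt t) * (drift t + s * slope t).

Lemma is_derive_gauss_cdf_curve (s t : R) : 0 < t ->
  is_derive t 1 (fun t : R => gauss_cdf ((g t - s) / Num.sqrt t)) (cdf_rate s t).
Proof.
move=> t0; have st : 0 < Num.sqrt t by rewrite sqrtr_gt0.
have gdt := gd t0.
have sd := is_derive1_sqrt t0.
have sv : is_derive t 1 (fun t : R => (Num.sqrt t)^-1)
    (- (Num.sqrt t) ^- 2 *: (2 * Num.sqrt t)^-1).
  by apply: is_deriveV; rewrite gt_eqF.
have yd : is_derive t 1 (fun t : R => (g t - s) / Num.sqrt t) (drift t + s * slope t).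
  apply: is_derive_eq.
  rewrite /drift /slope subr0 /GRing.scale /= sqr_sqrtr ?ltW//.
  by field; rewrite !gt_eqF.
have cd := is_derive_gauss_cdf ((g t - s) / Num.sqrt t).
have h : is_derive t 1
    (@gauss_cdf R \o (fun t : R => (g t - s) / Num.sqrt t)) (cdf_rate s t).
  exact: is_derive1_comp.
exact: h.
Qed.

Lemma continuous_curve (t : R) : 0 < t -> {for t, continuous g}.
Proof.
move=> t0; have [gt _] := gd t0.
by apply: differentiable_continuous; apply/derivable1_diffP.
Qed.

Lemma continuous_drift (t : R) : 0 < t -> {for t, continuous drift}.
Proof.
move=> t0; have st : Num.sqrt t != 0 by rewrite gt_eqF// sqrtr_gt0.
have sc : {for t, continuous (@Num.sqrt R)} by exact: sqrt_continuous.
apply: cvgB; apply: cvgM.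
- exact: g'c.
- exact: cvgV.
- exact: continuous_curve.
- apply: cvgV; first by rewrite !mulf_neq0// gt_eqF.
  by apply: cvgM => //; apply: cvgM; [exact: cvg_cst|exact: cvg_id].
Qed.

Lemma continuous_slope (t : R) : 0 < t -> {for t, continuous slope}.
Proof.
move=> t0; have st : Num.sqrt t != 0 by rewrite gt_eqF// sqrtr_gt0.
apply: cvgV; first by rewrite !mulf_neq0// gt_eqF.
apply: cvgM; last exact: sqrt_continuous.
by apply: cvgM; [exact: cvg_cst|exact: cvg_id].
Qed.

Lemma continuous_cdf_rate (s t : R) : 0 < t -> {for t, continuous (cdf_rate s)}.
Proof.
move=> t0; have st : Num.sqrt t != 0 by rewrite gt_eqF// sqrtr_gt0.
have yc : {for t, continuous (fun u : R => (g u - s) / Num.sqrt u)}.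
  apply: cvgM; last by apply: cvgV => //; exact: sqrt_continuous.
  by apply: cvgB; [exact: continuous_curve|exact: cvg_cst].
have pc : {for (g t - s) / Num.sqrt t, continuous (normal_pdf 0 (1 : R))}.
  exact: continuous_normal_pdf.
apply: cvgM; first exact: (continuous_comp yc pc).
apply: cvgD; first exact: continuous_drift.
by apply: cvgM; [exact: cvg_cst|exact: continuous_slope].
Qed.

Lemma integral_cdf_rate (s a b : R) : 0 < a -> a < b ->
  (\int[mu]_(t in `[a, b]) (cdf_rate s t)%:E =
   (gauss_cdf ((g b - s) / Num.sqrt b))%:E - (gauss_cdf ((g a - s) / Num.sqrt a))%:E)%E.
Proof.
move=> a0 ab.
have pos (t : R) : t \in `[a, b] -> 0 < t.
  by rewrite in_itv/= => /andP[/(lt_le_trans a0)].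
have dF (t : R) : 0 < t -> derivable (fun t : R => gauss_cdf ((g t - s) / Num.sqrt t)) t 1.
  by move=> t0; have [] := is_derive_gauss_cdf_curve s t0.
have cF (t : R) : 0 < t -> {for t, continuous (fun t : R => gauss_cdf ((g t - s) / Num.sqrt t))}.
  by move=> t0; apply: differentiable_continuous; apply/derivable1_diffP; exact: dF.
rewrite (@continuous_FTC2 R (cdf_rate s) (fun t : R => gauss_cdf ((g t - s) / Num.sqrt t)))//.
- apply: continuous_in_subspaceT => t; rewrite inE => /pos t0.
  exact: continuous_cdf_rate.
- split.
  + by move=> t; rewrite in_itv/= => /andP[/ltW/(lt_le_trans a0) t0 _]; exact: dF.
  + by apply: cvg_at_right_filter; exact: cF.
  + by apply: cvg_at_left_filter; apply: cF; exact: lt_trans ab.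
- move=> t; rewrite in_itv/= => /andP[ta _].
  have t0 : 0 < t by exact: lt_trans ta.
  by rewrite derive1E; have [] := is_derive_gauss_cdf_curve s t0.
Qed.

End first_passage_calculus.

Section survival_cdf.
Context (R : realType).
Local Notation mu := (@lebesgue_measure R).
Local Notation mR := (measurableTypeR R).
Local Notation itv0y := (`]0%R, +oo[%classic : set (measurableTypeR R)).
Variable G : {measure set (measurableTypeR R) -> \bar R}.
Hypotheses (sG : sigma_finite itv0y G) (Gint : gauss_integrable G).

Lemma measurable_gauss_cdf_shift (t y : R) :
  measurable_fun (setT : set mR) (fun s : R => gauss_cdf ((y - s) / Num.sqrt t)).
Proof.
apply: measurableT_comp.
  apply: continuous_measurable_fun => x.
  by apply: differentiable_continuous; apply/derivable1_diffP; have [] := is_derive_gauss_cdf x.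
by apply: measurable_funM => //; exact: measurable_funB.
Qed.

(** Left of the root the image term is bounded by the central Gaussian, whose integral is a value of
    [gauss_cdf]. Both terms of the kernel thus have finite integrals and can be separated; Tonelli's
    theorem integrates the image term in x first. *)
Lemma survival_gauss_cdf (t y : R) : 0 < t -> images_gap G t y = 0%E ->
  ((\int[G]_(s in `]0%R, +oo[) (gauss_cdf ((y - s) / Num.sqrt t))%:E)%E \is a fin_num) /\
  (\int[mu]_(x in `]-oo, y]) images_kernel G t x =
   (gauss_cdf (y / Num.sqrt t))%:E -
   \int[G]_(s in `]0%R, +oo[) (gauss_cdf ((y - s) / Num.sqrt t))%:E)%E.
Proof.
move=> t0 gap0.
have [G0 _ G0I] := restrict_sigma_finite sG.
set c := (Num.sqrt (2 * pi * t))^-1.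
have c0 : 0 <= c by rewrite invr_ge0 sqrtr_ge0.
pose p x s := c * expR (- ((x - s) ^+ 2 / (2 * t))).
have p0 x s : 0 <= p x s by rewrite mulr_ge0// expR_ge0.
have mp0 : measurable_fun (setT : set mR) (fun x => (p x 0)%:E).
  apply/measurable_EFinP; apply: measurable_funM => //.
  apply: measurableT_comp => //; apply: measurableT_comp => //.
  by apply: measurable_funM => //; apply: measurable_funX; exact: measurable_funB.
have mps x : measurable_fun (setT : set mR) (fun s => (p x s)%:E).
  by apply/measurable_EFinP; apply: measurable_funM => //; exact: measurable_gauss_shift.
pose J x := (\int[G0]_s (p x s)%:E)%E.
have kE x : images_kernel G t x = ((p x 0)%:E - J x)%E.
  rewrite /images_kernel /images_gap -/c muleBr//.
  rewrite -EFinM /p subr0; congr (_ - _)%E.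
  rewrite /J G0I//; last by move=> s; rewrite lee_fin p0.
  under [RHS]eq_integral do rewrite EFinM.
  rewrite ge0_integralZl//.
  by apply/measurable_EFinP; apply: measurable_funTS; exact: measurable_gauss_shift.
pose q (z : mR * mR) : \bar R := ((p z.1 z.2)%:E * (\1_(`]-oo, y]%classic : set R) z.1)%:E)%E.
have mq : measurable_fun setT q.
  apply: emeasurable_funM.
    apply/measurable_EFinP; apply: measurable_funM => //.
    apply: measurableT_comp => //; apply: measurableT_comp => //.
    by apply: measurable_funM => //; apply: measurable_funX; exact: measurable_funB.
  apply/measurable_EFinP; apply: (measurableT_comp (measurable_indic _)) => //.
have q0 z : (0 <= q z)%E by rewrite mule_ge0// lee_fin p0.
have mJ : measurable_fun (setT : set mR) J.
  pose q' (z : mR * mR) : \bar R := (p z.1 z.2)%:E.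
  apply: (@measurable_fun_fubini_tonelli_F _ _ _ _ _ G0 q'); last first.
    by move=> z; rewrite lee_fin p0.
  apply/measurable_EFinP; apply: measurable_funM => //.
  apply: measurableT_comp => //; apply: measurableT_comp => //.
  by apply: measurable_funM => //; apply: measurable_funX; exact: measurable_funB.
have J0 x : (0 <= J x)%E by apply: integral_ge0 => s _; rewrite lee_fin p0.
have Jle x : x <= y -> (J x <= (p x 0)%:E)%E.
  move=> xy; have := images_kernel_ge0 t0 xy gap0.
  by rewrite kE sube_ge0// orbT.
have Phi0 : (\int[mu]_(x in `]-oo, y]) (p x 0)%:E = (gauss_cdf (y / Num.sqrt t))%:E)%E.
  by rewrite integral_gauss_kernel// subr0.
have JE : (\int[mu]_(x in `]-oo, y]) J x =
    \int[G]_(s in `]0%R, +oo[) (gauss_cdf ((y - s) / Num.sqrt t))%:E)%E.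
  transitivity (\int[mu]_x \int[G0]_s q (x, s))%E.
    rewrite integral_mkcond; apply: eq_integral => x _.
    rewrite /q /= ge0_integralZr//; last by move=> s _; rewrite lee_fin p0.
    by rewrite epatch_indic.
  rewrite (fubini_tonelli q)//.
  rewrite -G0I//; last 2 first.
  - by apply/measurable_EFinP; exact: measurable_gauss_cdf_shift.
  - by move=> s; rewrite lee_fin gauss_cdf_ge0.
  apply: eq_integral => s _; rewrite -integral_gauss_kernel// [RHS]integral_mkcond.
  by apply: eq_integral => x _; rewrite epatch_indic.
have Jfin : (\int[mu]_(x in `]-oo, y]) J x < +oo)%E.
  apply: (@le_lt_trans _ _ (\int[mu]_(x in `]-oo, y]) (p x 0)%:E)%E); last by rewrite Phi0 ltry.
  by apply: ge0_le_integral => //; [exact: measurable_funTS|exact: measurable_funTS].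
split.
  rewrite -JE ge0_fin_numE// integral_ge0//.
rewrite -Phi0 -JE; under eq_integral do rewrite kE.
apply: integralB => //.
- apply/integrableP; split; first exact: measurable_funTS.
  under eq_integral do rewrite gee0_abs ?lee_fin ?p0//.
  by rewrite Phi0 ltry.
- apply/integrableP; split; first exact: measurable_funTS.
  by under eq_integral do rewrite gee0_abs//.
Qed.

End survival_cdf.

Section first_passage_fubini.
Context (R : realType) (g g' : R -> R).
Local Notation mu := (@lebesgue_measure R).
Local Notation mR := (measurableTypeR R).
Local Notation itv0y := (`]0%R, +oo[%classic : set (measurableTypeR R)).
Variable G : {measure set (measurableTypeR R) -> \bar R}.
Hypotheses (sG : sigma_finite itv0y G) (Gint : gauss_integrable G).
Hypothesis gd : forall t : R, 0 < t -> is_derive t 1 g (g' t).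
Hypothesis g'c : forall t : R, 0 < t -> {for t, continuous g'}.
Hypothesis groot : forall t : R, 0 < t -> images_gap G t (g t) = 0%E.

Definition passage_density (t : R) : \bar R :=
  ((2 * Num.sqrt (2 * pi * t ^+ 3))^-1%:E *
   \int[G]_(s in `]0%R, +oo[) (s * expR (- ((s - g t) ^+ 2 / (2 * t))))%:E)%E.

Lemma bounded_on_segment (h : R -> R) (a b : R) : a <= b ->
  (forall t, t \in `[a, b] -> {for t, continuous h}) ->
  exists M, forall t, t \in `[a, b] -> `|h t| <= M.
Proof.
move=> ab hc.
have nc : {within `[a, b], continuous (fun t => `|h t|)}.
  apply: continuous_in_subspaceT => t; rewrite inE => tab.
  by apply: cvg_norm; exact: hc.
by have [c _ cmax] := EVT_max ab nc; exists (`|h c|) => t /cmax.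
Qed.

Lemma abs_le_gauss (c s : R) : 0 < c -> `|s| <= (1 + c^-1) * expR (c * s ^+ 2).
Proof.
move=> c0; apply: (@le_trans _ _ ((1 + c^-1) * (1 + c * s ^+ 2))); last first.
  by rewrite ler_wpM2l ?expR_ge1Dx// addr_ge0// invr_ge0 ltW.
have -> : (1 + c^-1) * (1 + c * s ^+ 2) = 1 + s ^+ 2 + (c^-1 + c * s ^+ 2).
  by field; rewrite gt_eqF.
apply: (@le_trans _ _ (1 + s ^+ 2)); last first.
  rewrite lerDl; apply: addr_ge0; first by rewrite invr_ge0 ltW.
  by apply: mulr_ge0; [exact: ltW|exact: sqr_ge0].
rewrite -real_normK ?num_real// -subr_ge0.
have -> : 1 + `|s| ^+ 2 - `|s| = (`|s| - 2^-1) ^+ 2 + 3 / 4 by field.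
by rewrite addr_ge0 ?sqr_ge0.
Qed.

(** The domination behind Fubini's theorem, uniform in t on [a, b] and integrable in s against G:
    Gaussian decay outweighs the linear growth of drift + s slope. *)
Lemma cdf_rate_bound (a b : R) : 0 < a -> a < b ->
  exists C, forall t s, t \in `[a, b] ->
    `|cdf_rate g g' s t| <= C * expR (- ((4 * b)^-1 * s ^+ 2 / 2)).
Proof.
move=> a0 ab.
have pos (t : R) : t \in `[a, b] -> 0 < t.
  by rewrite in_itv/= => /andP[/(lt_le_trans a0)].
have [M1 M1P] := bounded_on_segment (ltW ab)
  (fun t tab => continuous_drift gd g'c (pos t tab)).
have [M2 M2P] := bounded_on_segment (ltW ab)
  (fun t tab => continuous_slope (pos t tab)).
have [M3 M3P] := bounded_on_segment (ltW ab)
  (fun t tab => continuous_curve gd (pos t tab)).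
have b0 : 0 < b by exact: lt_trans ab.
(* The Gaussian factor is at most a constant times exp (- 2 c s^2). Half of this decay pays for |s|
   <= (1 + 1 / c) exp (c s^2), and exp (- c s^2) is left. *)
pose c := (8 * b)^-1; have c0 : 0 < c by rewrite invr_gt0 mulr_gt0.
pose k := (Num.sqrt (2 * pi))^-1 : R.
have k0 : 0 <= k by rewrite invr_ge0 sqrtr_ge0.
exists (k * expR (M3 ^+ 2 / (2 * a)) * (M1 + (1 + c^-1) * M2)) => t s tab.
have t0 := pos _ tab.
have [ta tb] : a <= t /\ t <= b by move: tab; rewrite in_itv/= => /andP.
have st : 0 < Num.sqrt t by rewrite sqrtr_gt0.
rewrite /cdf_rate normrM ger0_norm ?normal_pdf_ge0// normal_pdf01E -/k.
have -> : ((g t - s) / Num.sqrt t) ^+ 2 / 2 = (g t - s) ^+ 2 / (2 * t).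
  by rewrite exprMn exprVn sqr_sqrtr ?ltW//; field; rewrite gt_eqF.
have e1 : expR (- ((g t - s) ^+ 2 / (2 * t))) <=
    expR (M3 ^+ 2 / (2 * a)) * expR (- (2 * c * s ^+ 2)).
  apply: le_trans (gauss_shift_le _ _ t0) _.
  apply: ler_pM; rewrite ?expR_ge0// ler_expR.
    apply: ler_pM; rewrite ?sqr_ge0 ?invr_ge0 ?mulr_ge0 ?(ltW t0)//.
      by rewrite -real_normK ?num_real// lerXn2r ?nnegrE ?M3P// (le_trans _ (M3P _ tab)).
    by rewrite lef_pV2 ?posrE ?mulr_gt0// ler_pM2l.
  rewrite lerN2 (_ : (2 * t)^-1 * s ^+ 2 / 2 = s ^+ 2 * (4 * t)^-1); last first.
    by field; rewrite gt_eqF.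
  rewrite (_ : 2 * c * s ^+ 2 = s ^+ 2 * (4 * b)^-1); last first.
    by rewrite /c; field; rewrite gt_eqF.
  by apply: ler_wpM2l; rewrite ?sqr_ge0// lef_pV2 ?posrE ?mulr_gt0// ler_pM2l.
have e2 : `|drift g g' t + s * slope t| <= (M1 + (1 + c^-1) * M2) * expR (c * s ^+ 2).
  apply: (le_trans (ler_normD _ _)); rewrite normrM mulrDl.
  have cs : 0 <= c * s ^+ 2 by rewrite mulr_ge0 ?sqr_ge0 ?ltW.
  have M10 : 0 <= M1 by exact: le_trans (M1P _ tab).
  apply: lerD.
    by apply: (le_trans (M1P _ tab)); rewrite ler_peMr// -expR0 ler_expR.
  by rewrite mulrAC; apply: ler_pM => //; [exact: abs_le_gauss|exact: M2P].
have -> : - ((4 * b)^-1 * s ^+ 2 / 2) = - (2 * c * s ^+ 2) + c * s ^+ 2.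
  by rewrite /c; field; rewrite gt_eqF.
rewrite expRD; apply: (@le_trans _ _ ((k * (expR (M3 ^+ 2 / (2 * a)) * expR (- (2 * c * s ^+ 2)))) *
   ((M1 + (1 + c^-1) * M2) * expR (c * s ^+ 2)))); last first.
  by rewrite le_eqVlt; apply/orP; left; apply/eqP; ring.
by apply: ler_pM => //; [rewrite mulr_ge0// expR_ge0|exact: ler_wpM2l].
Qed.

Lemma measurable_cdf_rate (t : R) :
  measurable_fun (setT : set mR) (fun s : R => cdf_rate g g' s t).
Proof.
apply: measurable_funM; last by apply: measurable_funD => //; exact: measurable_funM.
apply: (@measurableT_comp _ _ _ _ _ _ (normal_pdf 0 1)).
  exact: measurable_normal_pdf.
by apply: measurable_funM => //; exact: measurable_funB.
Qed.

Lemma integrable_cdf_rate (t : R) : 0 < t ->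
  G.-integrable itv0y (fun s => (cdf_rate g g' s t)%:E).
Proof.
move=> t0; have tt1 : t < t + 1 by rewrite ltrDl.
have [C CP] := cdf_rate_bound t0 tt1.
have tin : t \in `[t, t + 1] by rewrite in_itv/= lexx ltW.
have C0 : 0 <= C.
  have := CP t 0 tin; rewrite expr0n/= mulr0 mul0r oppr0 expR0 mulr1.
  exact: le_trans.
have eps0 : 0 < (4 * (t + 1))^-1 by rewrite invr_gt0 mulr_gt0// (lt_trans t0).
apply/integrableP; split.
  by apply/measurable_EFinP; apply: measurable_funTS; exact: measurable_cdf_rate.
apply: (@le_lt_trans _ _ (\int[G]_(s in `]0%R, +oo[)
    (C%:E * (expR (- ((4 * (t + 1))^-1 * s ^+ 2 / 2)))%:E))%E).
  apply: ge0_le_integral => //=.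
  - apply/measurable_EFinP; apply: measurableT_comp => //.
    by apply: measurable_funTS; exact: measurable_cdf_rate.
  - apply: emeasurable_funM => //.
    by apply/measurable_EFinP; apply: measurable_funTS; exact: measurable_gauss.
  - by move=> s _; rewrite -EFinM lee_fin CP.
rewrite ge0_integralZl//; last first.
  by apply/measurable_EFinP; apply: measurable_funTS; exact: measurable_gauss.
by rewrite lte_mul_pinfty//; exact: Gint.
Qed.

(** Vanishing of the kernel at g t says that the Gaussian factor satisfies int p(s) G(ds) = p(0).
    Integrated against G, the drift term therefore equals the rate at s = 0, and only the term in s
    slope survives. *)
Lemma cdf_rate_integral (t : R) : 0 < t -> passage_density t =
  (\int[G]_(s in `]0%R, +oo[) (cdf_rate g g' s t)%:E - (cdf_rate g g' 0 t)%:E)%E.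
Proof.
move=> t0; have irate := integrable_cdf_rate t0; have st : 0 < Num.sqrt t by rewrite sqrtr_gt0.
pose p s := normal_pdf 0 1 ((g t - s) / Num.sqrt t).
have pE s : p s = (Num.sqrt (2 * pi))^-1 * expR (- ((g t - s) ^+ 2 / (2 * t))).
  rewrite /p normal_pdf01E exprMn exprVn sqr_sqrtr ?ltW//.
  by congr (_ * expR (- _)); field; rewrite gt_eqF.
set k := (Num.sqrt (2 * pi))^-1 in pE.
have k0 : 0 <= k by rewrite invr_ge0 sqrtr_ge0.
have mp : measurable_fun (setT : set mR) p.
  have -> : p = (fun s => k * expR (- ((g t - s) ^+ 2 / (2 * t)))) by apply/funext.
  by apply: measurable_funM => //; exact: measurable_gauss_shift.
have intp : (\int[G]_(s in `]0%R, +oo[) (p s)%:E = (p 0)%:E)%E.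
  under eq_integral do rewrite pE EFinM.
  rewrite ge0_integralZl//; last first.
    by apply/measurable_EFinP; apply: measurable_funTS; exact: measurable_gauss_shift.
  rewrite -/(images_integral G t (g t)) (images_gap_eq0 _ _ _).1 ?groot//.
  by rewrite pE subr0.
have ip : G.-integrable itv0y (fun s => (p s)%:E).
  apply/integrableP; split; first by apply/measurable_EFinP; exact: measurable_funTS.
  under eq_integral do rewrite gee0_abs ?lee_fin ?normal_pdf_ge0//.
  by rewrite intp ltry.
have dens : passage_density t = (\int[G]_(s in `]0%R, +oo[) (s * slope t * p s)%:E)%E.
  have mf : measurable_fun (setT : set mR)
      (fun s => s * expR (- ((s - g t) ^+ 2 / (2 * t)))).
    apply: measurable_funM => //; apply: measurableT_comp => //.
    apply: measurableT_comp => //; apply: measurable_funM => //.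
    by apply: measurable_funX; exact: measurable_funB.
  rewrite /passage_density -ge0_integralZl//; last 2 first.
  - by apply/measurable_EFinP; exact: measurable_funTS.
  - move=> s; rewrite /= in_itv/= andbT => s0.
    by rewrite lee_fin mulr_ge0 ?expR_ge0// ltW.
  apply: eq_integral => s _; rewrite -EFinM pE; congr EFin.
  have -> : (s - g t) ^+ 2 = (g t - s) ^+ 2 by ring.
  rewrite /slope /k.
  have -> : Num.sqrt (2 * pi * t ^+ 3) = Num.sqrt (2 * pi) * (t * Num.sqrt t).
    have p0 : 0 <= 2 * pi :> R by rewrite mulr_ge0// pi_ge0.
    have -> : t ^+ 3 = t ^+ 2 * t by ring.
    by rewrite (sqrtrM _ p0) (sqrtrM _ (sqr_ge0 t)) sqrtr_sqr gtr0_norm.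
  have p0 : 0 < Num.sqrt (2 * pi) :> R by rewrite sqrtr_gt0 mulr_gt0// pi_gt0.
  by field; rewrite !gt_eqF.
have -> : ((cdf_rate g g' 0 t)%:E = \int[G]_(s in `]0%R, +oo[) (drift g g' t * p s)%:E)%E.
  under eq_integral do rewrite EFinM.
  rewrite integralZl// intp /cdf_rate mul0r addr0 mulrC EFinM.
  by rewrite /p.
have ipd : G.-integrable itv0y (fun s => (drift g g' t * p s)%:E).
  have mD : measurable itv0y by exact: measurable_itv.
  have := integrableZl mD (drift g g' t) ip.
  by apply: eq_integrable => // s _; rewrite EFinM.
rewrite dens -integralB//.
apply: eq_integral => s _; rewrite -EFinB; congr EFin.
by rewrite /cdf_rate -/(p s); ring.
Qed.

End first_passage_fubini.

Section first_passage_interval.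
Context (R : realType) (g g' : R -> R).
Local Notation mu := (@lebesgue_measure R).
Local Notation mR := (measurableTypeR R).
Local Notation itv0y := (`]0%R, +oo[%classic : set (measurableTypeR R)).
Variable G : {measure set (measurableTypeR R) -> \bar R}.
Hypotheses (sG : sigma_finite itv0y G) (Gint : gauss_integrable G).
Hypothesis gd : forall t : R, 0 < t -> is_derive t 1 g (g' t).
Hypothesis g'c : forall t : R, 0 < t -> {for t, continuous g'}.
Hypothesis groot : forall t : R, 0 < t -> images_gap G t (g t) = 0%E.

Lemma measurable_patch_pos (h : R -> R) :
  (forall t : R, 0 < t -> {for t, continuous h}) ->
  measurable_fun setT (h \_ `]0, +oo[).
Proof.
move=> hc; apply/(measurable_restrictT _ (measurable_itv _)).
apply: open_continuous_measurable_fun; first exact: interval_open.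
by move=> t; rewrite inE /= in_itv/= andbT => /hc.
Qed.

(** For each s the fundamental theorem of calculus integrates the rate over [a, b] into a difference
    of values of [gauss_cdf]. Fubini's theorem then yields the difference of the two expressions
    given by [survival_gauss_cdf]. *)
Lemma passage_density_interval (a b : R) : 0 < a -> a < b ->
  (\int[mu]_(t in `[a, b]) passage_density g G t =
   \int[mu]_(x in `]-oo, g a]) images_kernel G a x -
   \int[mu]_(x in `]-oo, g b]) images_kernel G b x)%E.
Proof.
move=> a0 ab; have b0 : 0 < b by exact: lt_trans ab.
have pos (t : R) : t \in `[a, b] -> 0 < t.
  by rewrite in_itv/= => /andP[/(lt_le_trans a0)].
have [G0 _ G0I] := restrict_sigma_finite sG.
have G0I' (phi : R -> \bar R) : measurable_fun (setT : set mR) phi ->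
    (\int[G0]_s phi s = \int[G]_(s in `]0%R, +oo[) phi s)%E.
  move=> mphi; rewrite integralE [RHS]integralE !G0I//.
  - exact: measurable_funeneg.
  - exact: measurable_funepos.
have gen (x y : \bar R) (p q : R) : x \is a fin_num -> y \is a fin_num ->
    ((p%:E - x) - (q%:E - y) = (y - x) - (q%:E - p%:E))%E.
  by case: x => // x _; case: y => // y _; rewrite -!EFinB; congr EFin; ring.
have [fa Ea] := survival_gauss_cdf sG a0 (groot a0).
have [fb Eb] := survival_gauss_cdf sG b0 (groot b0).
pose rt := (fun t : R => (Num.sqrt t)^-1) \_ `]0, +oo[.
pose gt := g \_ `]0, +oo[.
pose dt := drift g g' \_ `]0, +oo[.
pose lt := @slope R \_ `]0, +oo[.
have mgt : measurable_fun (setT : set mR) gt.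
  apply: measurable_patch_pos => t t0; exact: (continuous_curve gd t0).
have mdt : measurable_fun (setT : set mR) dt.
  by apply: measurable_patch_pos => t t0; exact: (continuous_drift gd g'c t0).
have mlt : measurable_fun (setT : set mR) lt.
  by apply: measurable_patch_pos => t t0; exact: continuous_slope.
have mrt : measurable_fun (setT : set mR) rt.
  apply: measurable_patch_pos => t t0; apply: cvgV.
    by rewrite gt_eqF// sqrtr_gt0.
  exact: sqrt_continuous.
(* The rate is regular only for t > 0, while Fubini's theorem asks for joint measurability on the
   plane: it is cut off to [a, b], and functions of time are set to 0 off the positive half-line. *)
pose rho (z : mR * mR) : \bar R := (\1_(`[a, b]%classic : set R) z.1 *
  (normal_pdf 0 1 ((gt z.1 - z.2) * rt z.1) * (dt z.1 + z.2 * lt z.1)))%:E.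
have mrho : measurable_fun setT rho.
  have m1 (h : R -> R) : measurable_fun (setT : set mR) h ->
      measurable_fun setT (fun z : mR * mR => h z.1).
    by move=> mh; apply: measurableT_comp.
  have m2 : measurable_fun setT (fun z : mR * mR => z.2 : R) by exact: measurable_snd.
  apply/measurable_EFinP; apply: measurable_funM.
    by apply: m1; exact: measurable_indic.
  apply: measurable_funM.
    apply: (@measurableT_comp _ _ _ _ _ _ (normal_pdf 0 1)).
      exact: measurable_normal_pdf.
    by apply: measurable_funM; [apply: measurable_funB => //|]; exact: m1.
  by apply: measurable_funD; [exact: m1|apply: measurable_funM => //; exact: m1].
have rhoE t s : t \in `[a, b] -> rho (t, s) = (cdf_rate g g' s t)%:E.
  move=> tab; have t0 : t \in (`]0%R, +oo[%classic : set R).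
    by rewrite inE /= in_itv/= andbT (pos t tab).
  rewrite /rho /= indicE mem_set// mul1r /gt /rt /dt /lt !patchE t0.
  by [].
have rho0 t s : t \notin `[a, b] -> rho (t, s) = 0%E.
  by move=> tab; rewrite /rho /= indicE memNset ?mul0r//; exact/negP.
have [C CP] := cdf_rate_bound gd g'c a0 ab.
have C0 : 0 <= C.
  have := CP a 0; rewrite in_itv/= lexx (ltW ab) => /(_ isT).
  by rewrite expr0n/= mulr0 mul0r oppr0 expR0 mulr1; exact: le_trans.
pose K := (\int[G]_(s in `]0%R, +oo[) (expR (- ((4 * b)^-1 * s ^+ 2 / 2)))%:E)%E.
have Koo : (K < +oo)%E by rewrite /K; apply: Gint; rewrite invr_gt0 mulr_gt0.
have irho : (mu \x G0)%E.-integrable setT rho.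
  apply/integrable12ltyP => //.
  apply: (@le_lt_trans _ _ (\int[mu]_(t in `[a, b]) (C%:E * K))%E); last first.
    rewrite integral_cst//= lebesgue_measure_itv/= lte_fin ab.
    rewrite lte_mul_pinfty//.
    - by rewrite mule_ge0// integral_ge0.
    - by rewrite fin_numM// ge0_fin_numE// integral_ge0.
    - by rewrite -EFinB ltry.
  rewrite [leRHS]integral_mkcond; apply: ge0_le_integral => //.
  - by move=> t _; apply: integral_ge0.
  - apply: (@measurable_fun_fubini_tonelli_F _ _ _ _ _ G0 (fun z => `|rho z|%E)) => //.
    exact: measurableT_comp.
  - by apply/(measurable_restrictT _ (measurable_itv _)); exact: measurable_cst.
  move=> t _; rewrite patchE; case: ifPn => [|tab]; last first.
    rewrite (_ : (fun s => _) = cst 0%E) ?integral0//.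
    by apply/funext => s; rewrite rho0 ?abse0//; move: tab; rewrite notin_setE => /negP.
  rewrite inE /= => tab.
  rewrite /K -ge0_integralZl//; last first.
    by apply/measurable_EFinP; apply: measurable_funTS; exact: measurable_gauss.
  have mabs : measurable_fun (setT : set mR) (fun s => `|rho (t, s)|%E).
    have m : measurable_fun setT (abse \o rho) by exact: measurableT_comp.
    exact: (measurableT_comp m (pair1_measurable t)).
  rewrite -G0I//; last 2 first.
  - apply: emeasurable_funM => //; apply/measurable_EFinP; exact: measurable_gauss.
  - by move=> s; rewrite mule_ge0.
  apply: ge0_le_integral => //.
  - apply: emeasurable_funM => //; apply/measurable_EFinP; exact: measurable_gauss.
  - move=> s _; rewrite -[leLHS]/(`|rho (t, s)|)%E rhoE//.
    by rewrite abse_EFin -EFinM lee_fin CP.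
have mab : measurable (`[a, b]%classic : set mR) by exact: measurable_itv.
pose H t := (\int[G0]_s rho (t, s))%E.
have iH : mu.-integrable setT H by exact: (integrable_fubini_F irho).
have HE t : t \in `[a, b] ->
    (H t = \int[G]_(s in `]0%R, +oo[) (cdf_rate g g' s t)%:E)%E.
  move=> tab; rewrite /H -G0I'; last first.
    by apply/measurable_EFinP; exact: measurable_cdf_rate.
  by apply: eq_integral => s _; exact: rhoE.
have r0c : {within `[a, b], continuous (cdf_rate g g' 0)}.
  apply: continuous_in_subspaceT => t; rewrite inE => /pos t0.
  exact: (@continuous_cdf_rate R g g' gd g'c 0 t t0).
have ir0 : mu.-integrable (`[a, b]%classic : set mR) (fun t => (cdf_rate g g' 0 t)%:E).
  by apply: continuous_compact_integrable => //; exact: segment_compact.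
transitivity (\int[mu]_(t in `[a, b]) (H t - (cdf_rate g g' 0 t)%:E))%E.
  apply: eq_integral => t; rewrite inE /= => tab.
  by rewrite (cdf_rate_integral Gint gd g'c groot (pos t tab)) HE.
rewrite integralB//; last exact: (integrableS _ mab _ iH).
rewrite (integral_cdf_rate gd g'c)// !subr0.
pose Psi t s := gauss_cdf ((g t - s) / Num.sqrt t).
have iPsi t : 0 < t -> G.-integrable itv0y (fun s => (Psi t s)%:E).
  move=> t0; have [ft _] := survival_gauss_cdf sG t0 (groot t0).
  apply/integrableP; split.
    by apply/measurable_EFinP; apply: measurable_funTS; exact: measurable_gauss_cdf_shift.
  under eq_integral do rewrite gee0_abs ?lee_fin ?gauss_cdf_ge0//.
  by rewrite -ge0_fin_numE// integral_ge0// => s _; rewrite lee_fin gauss_cdf_ge0.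
have -> : (\int[mu]_(t in `[a, b]) H t =
    \int[G]_(s in `]0%R, +oo[) (Psi b s)%:E - \int[G]_(s in `]0%R, +oo[) (Psi a s)%:E)%E.
  transitivity (\int[mu]_t H t)%E.
    rewrite integral_mkcond; apply: eq_integral => t _; rewrite patchE.
    case: ifPn => // tab; rewrite /H (_ : (fun s => _) = cst 0%E) ?integral0//.
    by apply/funext => s; rewrite rho0//; move: tab; rewrite notin_setE => /negP.
  rewrite /H (Fubini irho).
  transitivity (\int[G0]_s ((Psi b s)%:E - (Psi a s)%:E))%E.
    apply: eq_integral => s _; rewrite -(integral_cdf_rate gd g'c)// [RHS]integral_mkcond.
    apply: eq_integral => t _; rewrite patchE; case: ifPn => [|tab].
      by rewrite inE /= => tab; exact: rhoE.
    by rewrite rho0//; move: tab; rewrite notin_setE => /negP.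
  rewrite G0I'; last first.
    apply: emeasurable_funB; apply/measurable_EFinP; exact: measurable_gauss_cdf_shift.
  have mI : measurable itv0y by exact: measurable_itv.
  exact: (integralB mI (iPsi b b0) (iPsi a a0)).
rewrite Ea Eb; apply: (esym (gen _ _ _ _ fa fb)).
Qed.

End first_passage_interval.

(** On []p n, q n]] the restricted measures are finite and determined by half-open intervals; these
    sets increase to the whole half-line, and monotone continuity concludes. *)
Lemma eq_measure_positive_half_line (R : realType)
    (nu1 nu2 : {measure set (measurableTypeR R) -> \bar R}) :
  (forall p q : R, 0 < p -> p < q -> nu1 `]p, q]%classic = nu2 `]p, q]%classic) ->
  (forall p q : R, 0 < p -> p < q -> (nu1 `]p, q]%classic < +oo)%E) ->
  forall A : set (measurableTypeR R), measurable A -> A `<=` `]0, +oo[ ->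
  nu1 A = nu2 A.
Proof.
move=> nuE nufin A mA A0.
(* [q] starts at 2, because [p 0] is 1 and the interval must not be empty. *)
pose p n : R := n.+1%:R^-1; pose q n : R := n.+2%:R.
have p0 n : 0 < p n by rewrite invr_gt0.
have pq n : p n < q n.
  by apply: (@le_lt_trans _ _ 1); rewrite ?invf_le1 ?ler1n ?ltr1n.
pose D n : set (measurableTypeR R) := `]p n, q n]%classic.
have mD n : measurable (D n) by exact: measurable_itv.
have restrE n B : measurable B -> nu1 (B `&` D n) = nu2 (B `&` D n).
  move=> mB; rewrite -[LHS]/(mrestr nu1 (mD n) B) -[RHS]/(mrestr nu2 (mD n) B).
  pose cov (k : nat) : set (measurableTypeR R) := `](- k%:R), k%:R]%classic.
  apply: (@measure_unique _ R (measurableTypeR R) (@ocitv R) cov _ _ _ _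
    (mrestr nu1 (mD n)) (mrestr nu2 (mD n))) => //.
  - exact: ocitvI.
  - by move=> k; exists (- k%:R, k%:R).
  - rewrite -subTset => x _; exists (Num.truncn `|x|).+1 => //=.
    have /andP[_ xk] := truncn_itv (normr_ge0 x).
    by rewrite /cov /= in_itv/=; move: xk; rewrite ltr_norml => /andP[-> /ltW].
  - move=> _ [[c e] _ <-] /=; rewrite /mrestr.
    have -> : `]c, e]%classic `&` D n = `]Num.max c (p n), Num.min e (q n)]%classic.
      apply/seteqP; split => x; rewrite /D /= !in_itv/= gt_max le_min.
        by move=> [/andP[-> ->] /andP[-> ->]].
      by move=> /andP[/andP[-> ->] /andP[-> ->]].
    have [lt|ge] := ltP (Num.max c (p n)) (Num.min e (q n)).
      by apply: nuE => //; rewrite lt_max p0 orbT.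
    by rewrite set_itv_ge ?measure0// bnd_simp -leNgt.
  - move=> k; apply: le_lt_trans (nufin _ _ (p0 n) (pq n)).
    rewrite /= /mrestr; apply: le_measure; rewrite ?inE; last exact: subIsetr.
      by apply: measurableI => //; exact: measurable_itv.
    exact: mD.
have ndD : nondecreasing_seq (fun n => A `&` D n).
  apply/nondecreasing_seqP => n; apply/subsetPset; apply: setIS => x.
  rewrite /D /= !in_itv/= => /andP[px xq]; apply/andP; split.
    by apply: le_lt_trans px; rewrite lef_pV2 ?posrE// ler_nat.
  by apply: (le_trans xq); rewrite ler_nat.
have AE : A = \bigcup_n (A `&` D n).
  rewrite -setI_bigcupr; apply/seteqP; split => [x Ax|x []//]; split => //.
  have := A0 _ Ax; rewrite /= in_itv/= andbT => x0.
  have [k _ /(_ k (leqnn k)) kP] := near_infty_natSinv_lt (PosNum x0).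
  have /andP[_ xk] := truncn_itv (ltW x0).
  exists (maxn k (Num.truncn x)) => //; rewrite /D /= in_itv/=; apply/andP; split.
    by apply: le_lt_trans kP; rewrite lef_pV2 ?posrE// ler_nat ltnS leq_maxl.
  apply: (le_trans (ltW xk)); rewrite ler_nat; apply: leqW.
  by rewrite ltnS leq_maxr.
have mAD n : measurable (A `&` D n) by exact: measurableI.
have lim (nu : {measure set (measurableTypeR R) -> \bar R}) :
    nu A = limn (fun n => nu (A `&` D n)).
  rewrite [in LHS]AE; apply/esym/cvg_lim => //.
  by apply: nondecreasing_cvg_mu => //; exact: bigcupT_measurable.
by rewrite !lim; congr (limn _); apply/funext => n; exact: restrE.
Qed.

(** * Law of the hitting time *)

Section first_passage_law.
Context d (Omega : measurableType d) (R : realType) (P : probability Omega R).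
Variable X : R -> {RV P >-> R}.
Hypothesis HX : standard_brownian_motion X.
Variables (g g' : R -> R).
Variable G : {measure set (measurableTypeR R) -> \bar R}.
Hypotheses (gc : {within `[0, +oo[, continuous g}) (g0 : g 0 != 0)
  (gG : obtained_by_images X g G).
Hypothesis gd : forall t : R, 0 < t -> is_derive t 1 g (g' t).
Hypothesis g'c : forall t : R, 0 < t -> {for t, continuous g'}.
Local Notation mu := (@lebesgue_measure R).
Local Notation mR := (measurableTypeR R).
Local Notation T := (hitting_time X g).

Let sG : sigma_finite (`]0%R, +oo[%classic : set mR) G. Proof. by case: gG. Qed.
Let Gint : gauss_integrable G. Proof. by case: gG. Qed.
Let groot (t : R) : 0 < t -> images_gap G t (g t) = 0%E.
Proof.
by move=> t0; have [_ _ uniqG _] := gG; have [/images_kernel_eq0 + _] := uniqG _ t0; exact.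
Qed.

Lemma ae_below_curve (t : R) : 0 < t ->
  {ae P, forall w, (t%:E < T w)%E -> 0 < Num.sg (g 0) * (g t - X t w)}.
Proof.
move=> t0; have [X0 Xc _ _] := HX; apply: filterS X0 => w X0w tT.
have [h _] := @hitting_time_gtP Omega R (fun s => X s) g gc w t X0w g0 (Xc w) t0.
by apply: (h tT); rewrite in_itv/= lexx ltW.
Qed.

(** Were g 0 negative, surviving paths would lie above g, so the kernel at time 1 would have
    integral 0 over []-oo, g 1]]. Being nonnegative there, it would vanish almost everywhere,
    against the uniqueness of its root. The sign places surviving paths below g, where the kernel
    describes the law. *)
Lemma curve_start_gt0 : 0 < g 0.
Proof.
have [_ _ uniqG law] := gG; move: g0; rewrite neq_lt => /orP[g00|//]; exfalso.
pose A := `]-oo, g 1]%classic : set R.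
have mA : measurable A by exact: measurable_itv.
have P0 : P [set w | (1%:E < T w)%E /\ A (X 1 w)] = 0%E.
  rewrite -(measure0 P); apply: eq_measure_ae => //.
    apply: measurableI; first exact: (measurable_gt_hitting_time HX _ gc).
    exact: measurable_RV_preimage.
  apply: filterS (ae_below_curve ltr01) => w below; split => // -[/below].
  rewrite ltr0_sg// mulN1r oppr_gt0 subr_lt0 => gX.
  by rewrite /A /= in_itv/= leNgt gX.
have [K0 Kuniq] := uniqG _ (@ltr01 R).
have Kge0 x : A x -> (0 <= images_kernel G 1 x)%E.
  by rewrite /A /= in_itv/= => xg; exact: images_kernel_ge0 ltr01 xg (groot ltr01).
have mK : measurable_fun (A : set mR) (images_kernel G 1).
  by apply: measurable_funTS; exact: measurable_images_kernel.
have : (\int[mu]_(x in A) `|images_kernel G 1 x| = 0)%E.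
  rewrite -[RHS]P0 (law _ ltr01 A)//; apply: eq_integral => x; rewrite inE => /Kge0.
  by move=> /gee0_abs.
move=> /(ae_eq_integral_abs mu (mA : measurable (A : set mR)) mK).1 Kae.
pose I : set mR := `]g 1 - 1, g 1[%classic.
have : mu.-negligible I.
  apply: negligibleS Kae => x; rewrite /I /= in_itv/= => /andP[_ xg] h.
  have xA : A x by rewrite /A /= in_itv/= ltW.
  by have := Kuniq x (h xA) => gx; move: xg; rewrite gx ltxx.
have mI : measurable I by exact: measurable_itv.
move=> /(measure_negligible mI) I0.
have : (lebesgue_measure I = 1)%E.
  by rewrite /I lebesgue_measure_itv/= lte_fin ltrBlDr ltrDl ltr01 -EFinB; congr EFin; ring.
by rewrite [LHS]I0 => /eqP; rewrite eqe eq_sym oner_eq0.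
Qed.

Lemma survival_integral (t : R) : 0 < t ->
  P [set w | (t%:E < T w)%E] = (\int[mu]_(x in `]-oo, g t]) images_kernel G t x)%E.
Proof.
move=> t0; have [_ _ _ law] := gG.
rewrite -(law t t0 `]-oo, g t]%classic)//; apply: eq_measure_ae.
- exact: (measurable_gt_hitting_time HX _ gc).
- apply: measurableI; first exact: (measurable_gt_hitting_time HX _ gc).
  by apply: measurable_RV_preimage; exact: measurable_itv.
apply: filterS (ae_below_curve t0) => w below; split => [tT|[]//]; split => //.
have := below tT; rewrite gtr0_sg ?curve_start_gt0// mul1r subr_gt0 => /ltW.
by rewrite /= in_itv.
Qed.

Lemma measurable_passage_density :
  measurable_fun (setT : set mR) (passage_density g G \_ `]0, +oo[).
Proof.
have [G0 _ G0I] := restrict_sigma_finite sG.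
pose gt := g \_ `]0, +oo[.
pose ht := (fun t : R => (2 * t)^-1) \_ `]0, +oo[.
pose ct := (fun t : R => (2 * Num.sqrt (2 * pi * t ^+ 3))^-1) \_ `]0, +oo[.
have mgt : measurable_fun (setT : set mR) gt.
  by apply: measurable_patch_pos => t t0; exact: (continuous_curve gd t0).
have mht : measurable_fun (setT : set mR) ht.
  apply: measurable_patch_pos => t t0; apply: cvgV; first by rewrite mulf_neq0// gt_eqF.
  by apply: cvgM; [exact: cvg_cst|exact: cvg_id].
have mct : measurable_fun (setT : set mR) ct.
  apply: measurable_patch_pos => t t0.
  have c0 : 0 < 2 * pi * t ^+ 3 by rewrite !mulr_gt0// ?pi_gt0// exprn_gt0.
  apply: cvgV; first by rewrite mulf_neq0// gt_eqF// sqrtr_gt0.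
  apply: cvgM; first exact: cvg_cst.
  have c1 : {for t, continuous (fun t : R => 2 * pi * t ^+ 3)}.
    by apply: cvgM; [exact: cvg_cst|exact: exprn_continuous].
  have c2 : {for 2 * pi * t ^+ 3, continuous (@Num.sqrt R)} by exact: sqrt_continuous.
  exact: (continuous_comp c1 c2).
(* |s| replaces s to make the integrand nonnegative on the whole plane; on s > 0 nothing changes. *)
pose r (z : mR * mR) : \bar R :=
  (`|z.2 : R| * expR (- ((z.2 - gt z.1) ^+ 2 * ht z.1)))%:E.
have mr : measurable_fun setT r.
  have m1 (h : R -> R) : measurable_fun (setT : set mR) h ->
      measurable_fun setT (fun z : mR * mR => h z.1).
    by move=> mh; apply: measurableT_comp.
  have m2 : measurable_fun setT (fun z : mR * mR => z.2 : R) by exact: measurable_snd.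
  apply/measurable_EFinP; apply: measurable_funM; first exact: measurableT_comp.
  apply: measurableT_comp => //; apply: measurableT_comp => //.
  apply: measurable_funM; last exact: m1.
  by apply: measurable_funX; apply: measurable_funB => //; exact: m1.
have r0 z : (0 <= r z)%E by rewrite lee_fin mulr_ge0// expR_ge0.
have mF := measurable_fun_fubini_tonelli_F (m2 := G0) r mr r0.
rewrite (_ : _ \_ _ = fun t => ((ct t)%:E * fubini_F G0 r t)%E).
  by apply: emeasurable_funM => //; exact/measurable_EFinP.
apply/funext => t; rewrite /ct !patchE; case: ifPn => tpos; last by rewrite mul0e.
rewrite /passage_density; congr (_ * _)%E.
rewrite /fubini_F (G0I (fun s => r (t, s)))//; last first.
  exact: (measurableT_comp mr (pair1_measurable t)).
apply: eq_integral => s; rewrite inE /= in_itv/= andbT => s0.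
by rewrite /r /= gtr0_norm// /gt /ht !patchE tpos.
Qed.

(** On []p, q]] both sides equal P(T > p) - P(T > q), and such intervals determine both measures on
    the positive half-line. *)
Lemma first_passage_law (A : set R) : measurable A -> A `<=` `]0, +oo[ ->
  P (T @^-1` (EFin @` A)) = (\int[mu]_(t in A) passage_density g G t)%E.
Proof.
move=> mA A0; have [_ Xc _ _] := HX.
have mT : measurable_fun setT T.
  exact: (measurable_hitting_time (fun s => measurable_funPT (X s)) Xc gc).
(* [fine] sends infinite times to a default real value; restricting P to [fin] discards them. *)
pose fin : set Omega := [set w | T w \is a fin_num].
have mfin : measurable fin.
  have := mT measurableT `](-oo%E), (+oo%E)[%classic (emeasurable_itv _); rewrite setTI.
  congr (measurable _).
  by apply/seteqP; split => w; rewrite /fin /= in_itv/= fin_numElt.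
have mfT : measurable_fun setT (fine \o T : Omega -> mR).
  exact: measurableT_comp.
have [nu1 nu1E _] := exists_pushforward (mrestr P mfin) mfT.
have nu1P B : nu1 B = P (T @^-1` (EFin @` B)).
  rewrite nu1E; congr (P _); apply/seteqP; split => w /=.
    by move=> [Bw finw]; exists (fine (T w)) => //; rewrite fineK.
  by move=> [x Bx Tx]; split; rewrite /fin /= -Tx.
pose dens := passage_density g G \_ `]0, +oo[.
have dens0 (t : R) : (0 <= dens t)%E.
  apply: erestrict_ge0 => s _; rewrite mule_ge0 ?lee_fin ?invr_ge0 ?mulr_ge0 ?sqrtr_ge0//.
  apply: integral_ge0 => r; rewrite /= in_itv/= andbT => r0.
  by rewrite lee_fin mulr_ge0 ?expR_ge0// ltW.
have [nu2 nu2E] := exists_density_measure mu measurable_passage_density dens0.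
have nu2A (B : set mR) : B `<=` `]0, +oo[ ->
    nu2 B = (\int[mu]_(t in B) passage_density g G t)%E.
  move=> B0; rewrite nu2E; apply: eq_integral => t; rewrite inE => /B0 t0.
  by rewrite /dens patchE mem_set.
rewrite -nu1P -nu2A//; apply: eq_measure_positive_half_line => //.
- move=> p q p0 pq; have q0 : 0 < q by exact: lt_trans pq.
  have mgt t : measurable [set w | (t%:E < T w)%E] by exact: (measurable_gt_hitting_time HX _ gc).
  rewrite nu1P nu2A; last first.
    by move=> t; rewrite /= !in_itv/= andbT => /andP[/(lt_trans p0)].
  have -> : T @^-1` (EFin @` `]p, q]) =
      [set w | (p%:E < T w)%E] `\` [set w | (q%:E < T w)%E].
    apply/seteqP; split => w /=.
      by move=> [t]; rewrite in_itv/= => /andP[pt tq] <-; rewrite !lte_fin; split=> //;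
      apply/negP; rewrite -leNgt.
    move=> [pT /negP]; rewrite -leNgt => Tq.
    have fT : T w \is a fin_num.
      by rewrite fin_real// (lt_trans _ pT) ?ltNyr//= (le_lt_trans Tq) ?ltry.
    by exists (fine (T w)); rewrite ?fineK// in_itv/= -lte_fin -lee_fin fineK// pT.
  rewrite measureD//; last by rewrite ltey_eq fin_num_measure.
  rewrite setIidr; last by move=> w /=; apply: lt_trans; rewrite lte_fin.
  rewrite integral_itv_obnd_cbnd; last first.
    have mpos : measurable (`]0, +oo[%classic : set mR) by exact: measurable_itv.
    apply: (measurable_funS mpos); last first.
      by apply/(measurable_restrictT _ mpos); exact: measurable_passage_density.
    by apply: subset_itv; rewrite bnd_simp// ltW.
  rewrite (passage_density_interval sG Gint gd g'c groot p0 pq).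
  by rewrite -(survival_integral p0) -(survival_integral q0).
- move=> p q _ _; rewrite nu1E ltey_eq fin_num_measure//.
  by have := mfT measurableT _ (measurable_itv `]p, q]); rewrite setTI.
Qed.

End first_passage_law.

(** * Differentiability of the transformed curve *)

Section curve_transform_derivative.
Context (R : realType) (beta : R).
Hypothesis beta_gt0 : 0 < beta.
Implicit Types (f : R -> R) (t : R).

Lemma nbhs_half_line t : 0 < t -> nbhs t (`[0, +oo[%classic : set R).
Proof.
move=> t0; have : nbhs t [set y | 0 < y] by exact: lt_nbhsr.
by apply: filterS => y /= y0; rewrite in_itv/= ltW.
Qed.

Lemma within_continuous_at f t : {within `[0, +oo[, continuous f} -> 0 < t ->
  {for t, continuous f}.
Proof.
move=> /subspace_continuousP fc t0.
have t0' : (`[0, +oo[%classic : set R) t by rewrite /= in_itv/= ltW.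
move=> U hU.
have hU' : \forall y \near t, (`[0, +oo[%classic : set R) y -> U (f y) := fc t t0' U hU.
have : \forall y \near t, U (f y).
  by apply: filterS2 hU' (nbhs_half_line t0) => y h1 h2; exact: h1.
by [].
Qed.

Lemma derivative_within_is_derive f t l : derivative_within `[0, +oo[ f t l ->
  0 < t -> is_derive t 1 f l.
Proof.
move=> fl t0.
have cf : (fun h => h^-1 *: ((f \o shift t) (h *: 1) - f t)) @ 0^' --> l.
  have sh : (fun h : R => h + t) @ 0^' --> within (`[0, +oo[%classic : set R) t^'.
    move=> U; rewrite /= /within/= => /nbhs_ballP[e /= e0 eU].
    (* A radius at most t keeps t + h in the half-line, so the restriction to it disappears near
       t. *)
    apply/nbhs_ballP; exists (Num.min e t) => /=; first by rewrite lt_min e0.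
    move=> h /=; rewrite /ball/= sub0r normrN lt_min => /andP[he ht] h0.
    apply: eU; rewrite /ball/= ?in_itv/= ?andbT.
    - by rewrite opprD addrCA subrr addr0 normrN.
    - by rewrite -subr_eq0 addrK.
    - by move: ht; rewrite ltr_norml => /andP[]; lra.
  have := cvg_comp _ _ sh fl; apply: cvg_trans; apply: near_eq_cvg.
  near=> h; rewrite /= addrK /GRing.scale/= mulr1 mulrC//.
apply: DeriveDef; first by apply/cvg_ex; exists l.
exact/cvg_lim.
Unshelve. all: by end_near. Qed.

Lemma is_derive_bridge_time t : 0 < t ->
  is_derive t 1 (bridge_time beta) ((1 + beta * t) ^- 2).
Proof.
move=> t0; have b0 := onebt_gt0 beta_gt0 (ltW t0).
have dv : is_derive t 1 (fun t : R => (1 + beta * t)^-1)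
    (- beta * (1 + beta * t) ^- 2).
  have bn : 1 + beta * t != 0 by rewrite gt_eqF.
  have db : is_derive t 1 (fun t : R => 1 + beta * t) beta.
    by apply: is_derive_eq; rewrite /GRing.scale/=; ring.
  have := @is_deriveV _ _ t beta 1 bn db.
  by rewrite /GRing.scale/= mulNr mulrC mulNr.
have h : is_derive t 1 (fun t : R => t * (1 + beta * t)^-1) ((1 + beta * t) ^- 2).
  by apply: is_derive_eq; rewrite /GRing.scale/=; field; rewrite gt_eqF.
exact: h.
Qed.

Lemma is_derive_curve_transform f f' :
  (forall t, 0 < t -> is_derive t 1 f (f' t)) -> forall t, 0 < t ->
  is_derive t 1 (curve_transform beta f)
    (beta * f (bridge_time beta t) + f' (bridge_time beta t) / (1 + beta * t)).
Proof.
move=> fd t t0; have b0 := onebt_gt0 beta_gt0 (ltW t0).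
have v0 : 0 < bridge_time beta t by rewrite divr_gt0.
have fdv := fd _ v0; have dv := is_derive_bridge_time t0.
have h1 : is_derive t 1 (f \o bridge_time beta)
    (f' (bridge_time beta t) * (1 + beta * t) ^- 2) by exact: is_derive1_comp.
have db : is_derive t 1 (fun t : R => 1 + beta * t) beta.
  by apply: is_derive_eq; rewrite /GRing.scale/=; ring.
have h := is_deriveM db h1.
rewrite (_ : beta * _ + _ = (1 + beta * t) *: (f' (bridge_time beta t) * (1 + beta * t) ^- 2) +
   (f \o bridge_time beta) t *: beta); first exact: h.
by rewrite /GRing.scale/=; field; rewrite gt_eqF.
Qed.

Lemma continuous_curve_transform_derivative f f' :
  (forall t, 0 < t -> {for t, continuous f}) ->
  (forall t, 0 < t -> {for t, continuous f'}) -> forall t, 0 < t ->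
  {for t, continuous (fun t =>
    beta * f (bridge_time beta t) + f' (bridge_time beta t) / (1 + beta * t))}.
Proof.
move=> fc f'c t t0; have b0 := onebt_gt0 beta_gt0 (ltW t0).
have v0 : 0 < bridge_time beta t by rewrite divr_gt0.
have vc := continuous_bridge_time beta_gt0 (ltW t0).
apply: cvgD; apply: cvgM.
- exact: cvg_cst.
- exact: (continuous_comp vc (fc _ v0)).
- exact: (continuous_comp vc (f'c _ v0)).
apply: cvgV; first by rewrite gt_eqF.
by apply: cvgD; [exact: cvg_cst|apply: cvgM; [exact: cvg_cst|exact: cvg_id]].
Qed.

End curve_transform_derivative.

Lemma passage_density_tilt (R : realType)
    (F : {measure set (measurableTypeR R) -> \bar R}) (beta : R) (g : R -> R) (t : R) :
  passage_density g (tilt beta F) t = first_passage_density F beta g t.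
Proof.
rewrite /passage_density /first_passage_density; congr (_ * _)%E.
apply: integral_tilt => [|s s0]; last by rewrite mulr_ge0 ?expR_ge0// ltW.
apply: measurable_funM => //; apply: measurableT_comp => //.
apply: measurableT_comp => //; apply: measurable_funM => //.
by apply: measurable_funX; exact: measurable_funB.
Qed.

Unset Implicit Arguments.

Theorem proposition4p1 (R : realType) (d : measure_display)
    (Omega : measurableType d) (P : probability Omega R)
    (X : R -> {RV P >-> R}) (HX : standard_brownian_motion X)
    (f : R -> R)
    (fC1 : C_within 1 `[0, +oo[ f)
    (fsmooth : forall n : nat, C_within n `]0, +oo[ f)
    (f0 : f 0 != 0)
    (fconcave : @convex_function R R^o `[0, +oo[ (fun t => - f t))
    (fdecr : forall s t, 0 < s -> s <= t -> f t / t <= f s / s)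
    (F : {measure set (measurableTypeR R) -> \bar R})
    (fF : obtained_by_images X f F)
    (beta : R) (beta_gt0 : 0 < beta) :
  let fb := curve_transform beta f in
  [/\ forall A : set R, measurable A -> A `<=` `]0, +oo[ ->
        P (hitting_time X fb @^-1` (EFin @` A))
        = (\int[lebesgue_measure]_(t in A) first_passage_density F beta fb t)%E,
      obtained_by_images X fb (tilt beta F),
      forall t, 0 < t ->
        unique (fun x =>
          ((expR (- (x ^+ 2 / (2 * t))))%:E
           - \int[F]_(s in `]0%R, +oo[)
               (expR (- ((x - s) ^+ 2 / (2 * t)))
                * expR (- (beta * s ^+ 2 / 2)))%:E)%E = 0%E) (fb t)
    & forall t, 0 < t ->
      forall A : set R, measurable A -> A `<=` `]-oo, fb t] ->
        P [set w | (t%:E < hitting_time X fb w)%E /\ A (X t w)]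
        = (\int[lebesgue_measure]_(x in A)
            ((Num.sqrt (2 * pi * t))^-1%:E *
             ((expR (- (x ^+ 2 / (2 * t))))%:E
              - \int[F]_(s in `]0%R, +oo[)
                  (expR (- ((x - s) ^+ 2 / (2 * t)))
                   * expR (- (beta * s ^+ 2 / 2)))%:E)))%E].
Proof.
move=> fb; have [fc [f' fd [f'c _]]] := fC1.
have fdr (t : R) : 0 < t -> is_derive t 1 f (f' t).
  by move=> t0; apply: derivative_within_is_derive => //; apply: fd; rewrite /= in_itv/= ltW.
have fcr (t : R) : 0 < t -> {for t, continuous f} by exact: within_continuous_at.
have f'cr (t : R) : 0 < t -> {for t, continuous f'} by exact: within_continuous_at.
have fbd := is_derive_curve_transform beta_gt0 fdr.
have fb'c := continuous_curve_transform_derivative beta_gt0 fcr f'cr.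
have fbc := within_curve_transform beta_gt0 fc.
have fb0 : fb 0 != 0 by rewrite /fb curve_transform0.
have fbF : obtained_by_images X fb (tilt beta F).
  exact: (obtained_by_images_curve_transform HX fc f0 beta_gt0 fF).
have [_ _ root law] := fbF.
split => //.
- move=> A mA A0.
  (* The density is read off the images representation of [fb] itself, rather than transported from
     the law of the hitting time of f. *)
  rewrite (first_passage_law HX fbc fb0 fbF fbd fb'c)//.
  by apply: eq_integral => t _; exact: passage_density_tilt.
- move=> t t0; have [r1 r2] := root t t0; split.
    have /(images_kernel_eq0 _ _ t0) := r1.
    by rewrite /images_gap -/(images_integral _ _ _) images_integral_tilt.
  move=> x gx; apply: r2; apply/(images_kernel_eq0 _ _ t0).
  by rewrite /images_gap -/(images_integral _ _ _) images_integral_tilt.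
- move=> t t0 A mA Afb; rewrite (law t t0 A mA Afb).
  apply: eq_integral => x _.
  by rewrite /images_kernel /images_gap -/(images_integral _ _ _) images_integral_tilt.
Qed.
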